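(* The matroid $Q^{NF}_3(\mathsf{Q}_8)\oplus R_7$ is $2$-linearly representable (over some field) and is not algebraic, i.e. it is not algebraically representable over any field.
   Context: **Algebraic representations.** Let $M=(E,r)$ be a matroid on a finite ground set $E$ with rank function $r$, and let $\mathbb{K}$ be a field. An algebraic representation of $M$ over $\mathbb{K}$ is a map $\pi\colon E\to\mathbb{F}$, for some field extension $\mathbb{K}\subseteq\mathbb{F}$, such that for every $X\subseteq E$ the rank $r(X)$ equals the transcendence degree of $\mathbb{K}(\pi(X))$ over $\mathbb{K}$. If one exists, $M$ is algebraically representable over $\mathbb{K}$; $M$ is algebraic if it is algebraically representable over some field. **$k$-linear representations.** For $k\in\mathbb{N}$, $k\ge 1$, a $k$-linear representation of $M=(E,r)$ over a field $\mathbb{F}$ is a matrix over $\mathbb{F}$ whose columns are grouped into blocks of $k$ columns, one block for each $e\in E$, such that for every $X\subseteq E$, $r(X)=\frac1k\dim\operatorname{span}$ of all columns in the blocks of the elements of $X$. If one exists over some field, $M$ is $k$-linearly representable. **The matroid $Q^{NF}_3(\mathsf{Q}_8)$.** Let $\mathsf{Q}_8=\{\pm\mathsf{e},\pm\mathsf{i},\pm\mathsf{j},\pm\mathsf{k}\}$ be the quaternion group with identity $\mathsf{e}$. Let $\mathbb{F}_{49}$ be the field with 49 elements and $\zeta_4\in\mathbb{F}_{49}$ a primitive fourth root of unity. Let $\rho\colon\mathsf{Q}_8\to GL_2(\mathbb{F}_{49})$ be the representation $$\rho(\pm\mathsf{e})=\pm\begin{pmatrix}1&0\\0&1\end{pmatrix},\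 \rho(\pm\mathsf{i})=\pm\begin{pmatrix}\zeta_4&0\\0&-\zeta_4\end{pmatrix},\ \rho(\pm\mathsf{j})=\pm\begin{pmatrix}0&-1\\1&0\end{pmatrix},\ \rho(\pm\mathsf{k})=\pm\begin{pmatrix}0&-\zeta_4\\-\zeta_4&0\end{pmatrix}.$$ $Q^{NF}_3(\mathsf{Q}_8)$ is the matroid on the 28-element ground set $E=\{p_1,p_2,p_3\}\cup\{g^{(i)}: g\in\mathsf{Q}_8,\ i=1,2,3\}\cup\{O\}$ whose 2-linear representation over $\mathbb{F}_{49}$ is the $6\times 56$ matrix $\mathbf{A}^*_\rho$ with the following $6\times2$ column blocks (each written as three stacked $2\times 2$ blocks, $I_2$ the identity): $p_1\mapsto(I_2,0,0)^T$, $p_2\mapsto(0,I_2,0)^T$, $p_3\mapsto(0,0,I_2)^T$, $g^{(1)}\mapsto(-I_2,\rho(g),0)^T$, $g^{(2)}\mapsto(0,-I_2,\rho(g))^T$, $g^{(3)}\mapsto(\rho(g),0,-I_2)^T$, $O\mapsto(I_2,I_2,I_2)^T$, where $(A,B,C)^T$ denotes stacking $A$, $B$, $C$ vertically without transposing the individual blocks. That is, $r(X)$ is half of the rank of the submatrix formed by the blocks of the elements of $X$ (these ranks are all even, so this defines a matroid). **The Reid geometry $R_p$.** For a prime $p$, $R_p$ is the matroid with the $k$-linear representation, over any field of characteristic $p$, whose column blocks (three stacked $k\times k$ blocks, $I=I_k$) are $(I,0,0)^T$, $(0,I,0)^T$, $(0,0,I)^T$, $(I,I,0)^T$, $(I,0,I)^T$,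 $(0,I,m I)^T$ for $m=1,\dots,p-1$, and $(I,I,m I)^T$ for $m=1,\dots,p-1$. The matroid does not depend on $k$ or on the field of characteristic $p$; for $k=1$ this is an ordinary linear representation over $\mathbb{F}_p$. $R_7$ is the case $p=7$ (17 elements, rank 3). $\oplus$ denotes the direct sum of matroids. *)

(* Defs.v *)
From HB Require Import structures.
From mathcomp Require Import all_boot all_order all_algebra all_field.
From mathcomp Require Import ring.
From mathcomp.multinomials Require Import mpoly.

Set Implicit Arguments.
Unset Strict Implicit.
Unset Printing Implicit Defensive.

Import GRing.Theory.
Local Open Scope ring_scope.

Record matroid (E : finType) := Matroid {
  rk : {set E} -> nat;
  rk_le_card : forall X : {set E}, (rk X <= #|X|)%N;
  rk_mono : forall X Y : {set E}, X \subset Y -> (rk X <= rk Y)%N;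
  rk_submod : forall X Y : {set E},
    (rk (X :|: Y) + rk (X :&: Y) <= rk X + rk Y)%N
}.

Section DirectSum.
Variables (E1 E2 : finType) (M1 : matroid E1) (M2 : matroid E2).
Implicit Types X Y : {set E1 + E2}.

Definition dsum_rk X : nat := rk M1 (inl @^-1: X) + rk M2 (inr @^-1: X).

Lemma dsum_rk_le_card X : (dsum_rk X <= #|X|)%N.
Proof.
apply: leq_trans (leq_add (rk_le_card M1 _) (rk_le_card M2 _)) _.
rewrite -!sum1_card big_sumType /=; apply: eq_leq.
by congr (_ + _)%N; apply: eq_bigl => x; rewrite inE.
Qed.

Lemma dsum_rk_mono X Y : X \subset Y -> (dsum_rk X <= dsum_rk Y)%N.
Proof. by move=> sXY; apply: leq_add; apply: rk_mono; apply: preimsetS. Qed.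

Lemma dsum_rk_submod X Y :
  (dsum_rk (X :|: Y) + dsum_rk (X :&: Y) <= dsum_rk X + dsum_rk Y)%N.
Proof.
rewrite /dsum_rk !preimsetU !preimsetI addnACA [leqRHS]addnACA.
by apply: leq_add; apply: rk_submod.
Qed.

Definition dsum : matroid (E1 + E2)%type :=
  Matroid dsum_rk_le_card dsum_rk_mono dsum_rk_submod.

End DirectSum.

(* The block of e is the n x k matrix A e. Its columns are the rows of (A e)^T,
   so the row space of the sum below is the span of all columns in the blocks
   of the elements of X. *)
Definition block_rank (E : finType) (F : fieldType) (n k : nat)
    (A : E -> 'M[F]_(n, k)) (X : {set E}) : nat :=
  \rank (\sum_(e in X) <<(A e)^T>>)%MS.

Definition klinear_rep (E : finType) (M : matroid E) (k : nat) (F : fieldType)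
    (n : nat) (A : E -> 'M[F]_(n, k)) : Prop :=
  forall X : {set E}, (k * rk M X)%N = block_rank A X.

Definition klinear (k : nat) (E : finType) (M : matroid E) : Prop :=
  (0 < k)%N /\
  exists (F : fieldType) (n : nat) (A : E -> 'M[F]_(n, k)), klinear_rep M A.

Section BlockMatroid.
Variables (E : finType) (F : fieldType) (n k : nat) (A : E -> 'M[F]_(n, k)).
Hypothesis k_gt0 : (0 < k)%N.
Hypothesis kdvd : forall X : {set E}, (k %| block_rank A X)%N.
Implicit Types X Y : {set E}.

Definition block_matroid_rk X : nat := (block_rank A X %/ k)%N.

Lemma block_rank_le X : (block_rank A X <= #|X| * k)%N.
Proof.
rewrite -sum_nat_const /block_rank.
apply: (big_rec2 (fun (W : 'M_n) s => (\rank W <= s)%N)) => [|e s W _ leWs].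
  by rewrite mxrank0.
apply: leq_trans (mxrank_adds_leqif _ _) _.
by rewrite leq_add // mxrank_gen rank_leq_row.
Qed.

Lemma block_rank_mono X Y :
  X \subset Y -> (block_rank A X <= block_rank A Y)%N.
Proof.
move/subsetP => sXY; apply/mxrankS/sumsmx_subP => e /sXY eY.
exact: (sumsmx_sup e).
Qed.

Lemma block_rank_submod X Y :
  (block_rank A (X :|: Y) + block_rank A (X :&: Y)
     <= block_rank A X + block_rank A Y)%N.
Proof.
rewrite /block_rank -[leqRHS]mxrank_sum_cap; apply: leq_add; apply: mxrankS; last first.
  by rewrite sub_capmx; apply/andP; split; apply/sumsmx_subP => e;
     rewrite inE => /andP[eX eY]; apply: (sumsmx_sup e).
apply/sumsmx_subP => e; rewrite inE => /orP[] eX.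
  by apply: submx_trans (addsmxSl _ _); apply: (sumsmx_sup e).
by apply: submx_trans (addsmxSr _ _); apply: (sumsmx_sup e).
Qed.

Lemma block_matroid_rkK X : (k * block_matroid_rk X)%N = block_rank A X.
Proof. by rewrite mulnC divnK. Qed.

Lemma block_matroid_le_card X : (block_matroid_rk X <= #|X|)%N.
Proof.
by rewrite -(leq_pmul2l k_gt0) block_matroid_rkK mulnC block_rank_le.
Qed.

Lemma block_matroid_mono X Y :
  X \subset Y -> (block_matroid_rk X <= block_matroid_rk Y)%N.
Proof.
by move=> sXY; rewrite -(leq_pmul2l k_gt0) !block_matroid_rkK block_rank_mono.
Qed.

Lemma block_matroid_submod X Y :
  (block_matroid_rk (X :|: Y) + block_matroid_rk (X :&: Y)
     <= block_matroid_rk X + block_matroid_rk Y)%N.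
Proof.
by rewrite -(leq_pmul2l k_gt0) !mulnDr !block_matroid_rkK block_rank_submod.
Qed.

Definition block_matroid : matroid E :=
  Matroid block_matroid_le_card block_matroid_mono block_matroid_submod.

End BlockMatroid.

Section Algebraic.
Variables (K F : fieldType) (iota : {rmorphism K -> F}).

(* The field extension K(S) inside F, for an arbitrary subset S of F. *)
Inductive adjoin (S : F -> Prop) : F -> Prop :=
| adjoin_base a : adjoin S (iota a)
| adjoin_gen x : S x -> adjoin S x
| adjoin_sub x y : adjoin S x -> adjoin S y -> adjoin S (x - y)
| adjoin_mul x y : adjoin S x -> adjoin S y -> adjoin S (x * y)
| adjoin_inv x : adjoin S x -> adjoin S x^-1.

Definition algebraic_over (L : F -> Prop) (x : F) : Prop :=
  exists p : {poly F}, [/\ p != 0, forall i, L p`_i & root p x].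

Definition alg_independent (n : nat) (b : n.-tuple F) : Prop :=
  forall p : {mpoly K[n]}, mmap iota (tnth b) p = 0 -> p = 0.

(* The transcendence degree of L over K is n: L has a transcendence basis over
   K with n elements. *)
Definition trdeg_is (L : F -> Prop) (n : nat) : Prop :=
  exists b : n.-tuple F,
    [/\ forall x, x \in b -> L x,
        alg_independent b
      & forall x, L x -> algebraic_over (adjoin (fun y => y \in b)) x].

Definition algebraic_rep (E : finType) (M : matroid E) (pi : E -> F) : Prop :=
  forall X : {set E},
    trdeg_is (adjoin (fun x => exists2 e, e \in X & x = pi e)) (rk M X).

End Algebraic.

Definition algebraic_over_field (K : fieldType) (E : finType) (M : matroid E) :
    Prop :=
  exists (F : fieldType) (iota : {rmorphism K -> F}) (pi : E -> F),
    algebraic_rep iota M pi.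

Definition algebraic_matroid (E : finType) (M : matroid E) : Prop :=
  exists K : fieldType, algebraic_over_field K M.

Definition stack3 (F : fieldType) (k : nat) (A B C : 'M[F]_k) :
    'M[F]_(k + (k + k), k) :=
  col_mx A (col_mx B C).

(* R01 i and R11 i carry the parameter m = i + 1, so that 1 <= m <= p - 1. *)
Inductive reid_elt (p : nat) :=
  | R100 | R010 | R001 | R110 | R101 | R01 of 'I_p.-1 | R11 of 'I_p.-1.

Section ReidFinite.
Variable p : nat.

Definition reid_encode (e : reid_elt p) : 'I_5 + ('I_p.-1 + 'I_p.-1) :=
  match e with
  | R100 => inl (inord 0) | R010 => inl (inord 1) | R001 => inl (inord 2)
  | R110 => inl (inord 3) | R101 => inl (inord 4)
  | R01 i => inr (inl i) | R11 i => inr (inr i)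
  end.

Definition reid_decode (x : 'I_5 + ('I_p.-1 + 'I_p.-1)) : reid_elt p :=
  match x with
  | inl i => nth (R100 p) [:: R100 p; R010 p; R001 p; R110 p; R101 p] i
  | inr (inl i) => R01 i
  | inr (inr i) => R11 i
  end.

Lemma reid_encodeK : cancel reid_encode reid_decode.
Proof. by case=> [|||||i|i] //=; rewrite inordK. Qed.

Lemma reid_decodeK : cancel reid_decode reid_encode.
Proof.
case=> [[[|[|[|[|[|m]]]]] lt_m]|[i|i]] //=;
by congr inl; apply: val_inj; rewrite /= inordK.
Qed.

HB.instance Definition _ := Finite.copy (reid_elt p) (can_type reid_encodeK).

End ReidFinite.

Definition reid_block (p : nat) (F : fieldType) (k : nat) (e : reid_elt p) :
    'M[F]_(k + (k + k), k) :=
  match e with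
  | R100 => stack3 1%:M 0 0
  | R010 => stack3 0 1%:M 0
  | R001 => stack3 0 0 1%:M
  | R110 => stack3 1%:M 1%:M 0
  | R101 => stack3 1%:M 0 1%:M
  | R01 i => stack3 0 1%:M i.+1%:R%:M
  | R11 i => stack3 1%:M 1%:M i.+1%:R%:M
  end.

Lemma reid_dvd (p : nat) (X : {set reid_elt p}) :
  (1 %| block_rank (@reid_block p 'F_p 1) X)%N.
Proof. exact: dvd1n. Qed.

(* R_p for p prime, given by its representation with k = 1 over the prime
   field. *)
Definition reid (p : nat) : matroid (reid_elt p) :=
  block_matroid (ltn0Sn 0) (@reid_dvd p).

Lemma card_reid7 : #|{: reid_elt 7}| = 17%N.
Proof.
rewrite (bij_eq_card (Bijective (@reid_encodeK 7) (@reid_decodeK 7))).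
by rewrite !card_sum !card_ord.
Qed.

Inductive q8_unit := Qe | Qi | Qj | Qk.

Definition q8_unit_encode (u : q8_unit) : bool * bool :=
  match u with
  | Qe => (false, false) | Qi => (false, true)
  | Qj => (true, false) | Qk => (true, true)
  end.

Definition q8_unit_decode (x : bool * bool) : q8_unit :=
  match x with
  | (false, false) => Qe | (false, true) => Qi
  | (true, false) => Qj | (true, true) => Qk
  end.

Lemma q8_unit_encodeK : cancel q8_unit_encode q8_unit_decode.
Proof. by case. Qed.

Lemma q8_unit_decodeK : cancel q8_unit_decode q8_unit_encode.
Proof. by case=> [[] []]. Qed.

HB.instance Definition _ := Finite.copy q8_unit (can_type q8_unit_encodeK).

(* (s, u) is the element u if s = false and -u if s = true. *)
Definition q8 : finType := (bool * q8_unit)%type.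

Definition mx2 (R : nzRingType) (a b c d : R) : 'M[R]_2 :=
  \matrix_(i < 2, j < 2) nth 0 (nth [::] [:: [:: a; b]; [:: c; d]] i) j.

Definition q8_rho (F : fieldType) (zeta : F) (g : q8) : 'M[F]_2 :=
  (-1) ^+ g.1 *:
  match g.2 with
  | Qe => mx2 1 0 0 1
  | Qi => mx2 zeta 0 0 (- zeta)
  | Qj => mx2 0 (-1) 1 0
  | Qk => mx2 0 (- zeta) (- zeta) 0
  end.

(* The ground set of Q_3^NF(Q_8): Pi is p_i, Gi g is g^(i), PO is O. *)
Inductive qnf_elt :=
  | P1 | P2 | P3 | G1 of q8 | G2 of q8 | G3 of q8 | PO.

Definition qnf_encode (e : qnf_elt) : 'I_4 + (q8 + (q8 + q8)) :=
  match e with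
  | P1 => inl (inord 0) | P2 => inl (inord 1) | P3 => inl (inord 2)
  | PO => inl (inord 3)
  | G1 g => inr (inl g) | G2 g => inr (inr (inl g)) | G3 g => inr (inr (inr g))
  end.

Definition qnf_decode (x : 'I_4 + (q8 + (q8 + q8))) : qnf_elt :=
  match x with
  | inl i => nth P1 [:: P1; P2; P3; PO] i
  | inr (inl g) => G1 g
  | inr (inr (inl g)) => G2 g
  | inr (inr (inr g)) => G3 g
  end.

Lemma qnf_encodeK : cancel qnf_encode qnf_decode.
Proof. by case=> [|||g|g|g|] //=; rewrite inordK. Qed.

Lemma qnf_decodeK : cancel qnf_decode qnf_encode.
Proof.
case=> [[[|[|[|[|m]]]] lt_m]|[g|[g|g]]] //=;
by congr inl; apply: val_inj; rewrite /= inordK.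
Qed.

HB.instance Definition _ := Finite.copy qnf_elt (can_type qnf_encodeK).

Lemma card_qnf : #|{: qnf_elt}| = 28%N.
Proof.
rewrite (bij_eq_card (Bijective qnf_encodeK qnf_decodeK)).
rewrite !card_sum !card_ord !card_prod card_bool.
by rewrite (bij_eq_card (Bijective q8_unit_encodeK q8_unit_decodeK))
   card_prod card_bool.
Qed.

Definition qnf_block (F : fieldType) (zeta : F) (e : qnf_elt) :
    'M[F]_(2 + (2 + 2), 2) :=
  match e with
  | P1 => stack3 1%:M 0 0
  | P2 => stack3 0 1%:M 0
  | P3 => stack3 0 0 1%:M
  | G1 g => stack3 (- 1%:M) (q8_rho zeta g) 0
  | G2 g => stack3 0 (- 1%:M) (q8_rho zeta g)
  | G3 g => stack3 (q8_rho zeta g) 0 (- 1%:M)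
  | PO => stack3 1%:M 1%:M 1%:M
  end.

(* All ranks are even for zeta^2 = -1 in characteristic 7: every n . e with n in
   q_normals and e a block of the matrix lies in the image of the integral
   quaternions and is zero or of norm prime to 7, hence zero or invertible. *)
Section QnfEven.

Definition quat : Type := (int * int * int * int)%type.
Definition qadd (x y : quat) : quat :=
  let: (a, b, c, d) := x in let: (a', b', c', d') := y in
  (a + a', b + b', c + c', d + d').
Definition qmul (x y : quat) : quat :=
  let: (a, b, c, d) := x in let: (a', b', c', d') := y in
  (a * a' - b * b' - c * c' - d * d', a * b' + b * a' + c * d' - d * c',
   a * c' - b * d' + c * a' + d * b', a * d' + b * c' - c * b' + d * a').
Definition qnorm (x : quat) : int :=
  let: (a, b, c, d) := x in a * a + b * b + c * c + d * d.
Definition q0 : quat := (0, 0, 0, 0).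
Definition q1 : quat := (1, 0, 0, 0).
Definition qm1 : quat := (-1, 0, 0, 0).
Definition qunit (x : quat) : bool := (`|qnorm x| %% 7 != 0)%N.
Definition qgood (x : quat) : bool := (x == q0) || qunit x.

Definition qof (g : q8) : quat :=
  let s : int := if g.1 then -1 else 1 in
  match g.2 with
  | Qe => (s, 0, 0, 0) | Qi => (0, s, 0, 0)
  | Qj => (0, 0, s, 0) | Qk => (0, 0, 0, s)
  end.

Definition q8s : seq q8 :=
  [seq (s, u) | s <- [:: false; true], u <- [:: Qe; Qi; Qj; Qk]].

Definition qnfs : seq qnf_elt :=
  [:: P1; P2; P3; PO] ++ [seq G1 g | g <- q8s] ++ [seq G2 g | g <- q8s]
    ++ [seq G3 g | g <- q8s].

Definition qnf_eqb (e f : qnf_elt) : bool :=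
  match e, f with
  | P1, P1 | P2, P2 | P3, P3 | PO, PO => true
  | G1 (s, u), G1 (t, v) | G2 (s, u), G2 (t, v) | G3 (s, u), G3 (t, v) =>
      (s == t) && (q8_unit_encode u == q8_unit_encode v)
  | _, _ => false
  end.

Definition q_block (e : qnf_elt) : quat * quat * quat :=
  match e with
  | P1 => (q1, q0, q0) | P2 => (q0, q1, q0) | P3 => (q0, q0, q1)
  | G1 g => (qm1, qof g, q0)
  | G2 g => (q0, qm1, qof g)
  | G3 g => (qof g, q0, qm1)
  | PO => (q1, q1, q1)
  end.

Definition q_dot (n e : quat * quat * quat) : quat :=
  let: (n1, n2, n3) := n in let: (e1, e2, e3) := e in
  qadd (qmul n1 e1) (qadd (qmul n2 e2) (qmul n3 e3)).

Definition q_normals : seq (quat * quat * quat) :=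
  let s := map qof q8s in
  [:: (q1, q0, q0); (q0, q1, q0); (q0, q0, q1)] ++
  flatten [seq [:: (a, q1, q0); (q0, a, q1); (q1, q0, a);
     (a, q1, qadd qm1 (qmul qm1 a)); (qadd qm1 (qmul qm1 a), a, q1);
     (q1, qadd qm1 (qmul qm1 a), a)] | a <- s] ++
  flatten [seq [:: (qmul b a, b, q1); (q1, qmul b a, b); (b, q1, qmul b a)]
     | a <- s, b <- s].

Definition q_has_unit (n : quat * quat * quat) : bool :=
  let: (n1, n2, n3) := n in [|| qunit n1, qunit n2 | qunit n3].

Definition q_good_normals : seq (quat * quat * quat) :=
  [seq n <- q_normals
     | q_has_unit n && all (fun g => qgood (q_dot n (q_block g))) qnfs].

(* [if] and [find] instead of [&&] and [has], which vm_compute evaluates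
   eagerly. *)
Definition q_pair_ok (ns : seq (quat * quat * quat)) (e f : qnf_elt) : bool :=
  let: x := q_block e in let: y := q_block f in
  if qnf_eqb e f then true else
  if (find (fun n => if q_dot n x == q0 then q_dot n y == q0 else false) ns
        < size ns)%N
  then (find (fun n => if q_dot n x == q0 then qunit (q_dot n y) else false) ns
        < size ns)%N
  else false.

Lemma q_pairs_ok :
  let ns := q_good_normals in all (fun e => all (q_pair_ok ns e) qnfs) qnfs.
Proof. by vm_compute. Qed.

Lemma mem_q8s (g : q8) : g \in q8s.
Proof. by case: g => [[] []]. Qed.

Lemma mem_qnfs (e : qnf_elt) : e \in qnfs.
Proof.
rewrite /qnfs; move: q8s mem_q8s => s ms.
by case: e => [|||g|g|g|]; rewrite !mem_cat ?map_f ?ms ?inE ?eqxx ?orbT.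
Qed.

Lemma qnf_eqbP (e f : qnf_elt) : qnf_eqb e f -> e = f.
Proof.
case: e => [|||[s u]|[s u]|[s u]|]; case: f => [|||[t v]|[t v]|[t v]|] //=;
by case/andP=> /eqP-> /eqP/(can_inj q8_unit_encodeK)->.
Qed.

Lemma q_pair_okP ns e f : q_pair_ok ns e f -> e <> f ->
  (exists2 n, n \in ns
     & q_dot n (q_block e) = q0 /\ q_dot n (q_block f) = q0) /\
  (exists2 n, n \in ns
     & q_dot n (q_block e) = q0 /\ qunit (q_dot n (q_block f))).
Proof.
rewrite /q_pair_ok -!has_find; case: ifP => [/qnf_eqbP->|_] //.
case: ifP => // /hasP[n n_ok]; case: ifP => // /eqP ne /eqP nf.
case/hasP => m m_ok; case: ifP => // /eqP me mf _.
by split; [exists n | exists m].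
Qed.

Variables (F : fieldType) (zeta : F).
Hypothesis zeta2 : zeta ^+ 2 = -1.
Hypothesis pchar7 : 7%N \in [pchar F].

Definition qmx (x : quat) : 'M[F]_2 :=
  let: (a, b, c, d) := x in
  mx2 (a%:~R + b%:~R * zeta) (- c%:~R - d%:~R * zeta)
      (c%:~R - d%:~R * zeta) (a%:~R - b%:~R * zeta).

Lemma det_mx2 (a b c d : F) : \det (mx2 a b c d) = a * d - b * c.
Proof.
rewrite (expand_det_row _ 0) !big_ord_recl big_ord0 /cofactor !det_mx11 !mxE /=.
by rewrite /bump /=; ring.
Qed.

Lemma mx2P (A B : 'M[F]_2) :
  A 0 0 = B 0 0 -> A 0 1 = B 0 1 -> A 1 0 = B 1 0 -> A 1 1 = B 1 1 -> A = B.
Proof.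
move=> h00 h01 h10 h11; apply/matrixP => i j.
have E2 (k : 'I_2) : k = 0 \/ k = 1.
  by case: k => [[|[|k]] lt_k] //; [left | right]; apply: val_inj.
by case: (E2 i) => ->; case: (E2 j) => ->.
Qed.

Lemma qmxD x y : qmx (qadd x y) = qmx x + qmx y.
Proof.
case: x => [[[a b] c] d]; case: y => [[[a' b'] c'] d'].
by apply: mx2P; rewrite !mxE /= !rmorphD /=; ring.
Qed.

Lemma qmxM x y : qmx (qmul x y) = qmx x *m qmx y.
Proof.
case: x => [[[a b] c] d]; case: y => [[[a' b'] c'] d'].
have z2 : zeta * zeta = -1 by rewrite -expr2.
by apply: mx2P; rewrite !mxE !big_ord_recl big_ord0 !mxE /=
  !(rmorphD, rmorphB, rmorphM) /=; ring: z2.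
Qed.

Lemma qmx0 : qmx q0 = 0.
Proof. by apply: mx2P; rewrite !mxE /=; ring. Qed.

Lemma qmx1 : qmx q1 = 1%:M.
Proof. by apply: mx2P; rewrite !mxE /=; ring. Qed.

Lemma qmxm1 : qmx qm1 = - 1%:M.
Proof. by apply: mx2P; rewrite !mxE /=; ring. Qed.

Lemma qmx_of g : qmx (qof g) = q8_rho zeta g.
Proof. by case: g => [[] []]; apply: mx2P; rewrite !mxE /=; ring. Qed.

Lemma qmx_unit x : qunit x -> qmx x \in unitmx.
Proof.
case: x => [[[a b] c] d] nz; rewrite unitmxE det_mx2 unitfE.
have z2 : zeta * zeta = -1 by rewrite -expr2.
rewrite (_ : _ - _ = (qnorm (a, b, c, d))%:~R); last first.
  by rewrite /qnorm !(rmorphD, rmorphM) /=; ring: z2.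
move: nz; rewrite /qunit; case: (qnorm _) => n /=.
  by rewrite -pmulrn -(dvdn_pcharf pchar7).
by rewrite NegzE rmorphN /= oppr_eq0 -pmulrn -(dvdn_pcharf pchar7).
Qed.

Definition qrow (n : quat * quat * quat) : 'M[F]_(2, 2 + (2 + 2)) :=
  let: (n1, n2, n3) := n in row_mx (qmx n1) (row_mx (qmx n2) (qmx n3)).

Lemma q_dotP n e : qrow n *m qnf_block zeta e = qmx (q_dot n (q_block e)).
Proof.
case: n => [[n1 n2] n3].
by case: e => [|||g|g|g|] /=;
   rewrite /stack3 !mul_row_col !qmxD !qmxM !(qmx_of, qmx0, qmx1, qmxm1).
Qed.

Let V (e : qnf_elt) : 'M[F]_(2 + (2 + 2)) := <<(qnf_block zeta e)^T>>%MS.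
Let N n : 'M[F]_(2 + (2 + 2), 2) := (qrow n)^T.

Let rkVN e n : \rank (V e *m N n) = \rank (qmx (q_dot n (q_block e))).
Proof.
by rewrite (eqmxMr _ (genmxE _)) /N -trmx_mul q_dotP mxrank_tr.
Qed.

Let VN0 e n : q_dot n (q_block e) = q0 -> V e *m N n = 0.
Proof. by move=> h; apply/eqP; rewrite -mxrank_eq0 rkVN h qmx0 mxrank0. Qed.

Let VN1 e n : qunit (q_dot n (q_block e)) -> \rank (V e *m N n) = 2.
Proof. by move/qmx_unit/mxrank_unit; rewrite rkVN. Qed.

Let rkV_le e : (\rank (V e) <= 2)%N.
Proof. by rewrite mxrank_gen rank_leq_row. Qed.


Let rkN n : n \in q_good_normals -> \rank (N n) = 2.
Proof.
rewrite mem_filter => /andP[/andP[un _] _]; rewrite mxrank_tr.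
apply/eqP; rewrite eqn_leq rank_leq_row /=.
have key m (x : quat) (C : 'M[F]_(_, m)) (D : 'M[F]_(m, 2)) :
    qrow n *m (C *m D) = qmx x -> qunit x -> (2 <= \rank (qrow n))%N.
  move=> nC /qmx_unit/mxrank_unit rx.
  by have := mxrankM_maxl (qrow n) (C *m D); rewrite nC rx.
case: n un key => [[n1 n2] n3] /= un key.
pose c1 : 'M[F]_(2 + (2 + 2), 2) := stack3 1%:M 0 0.
pose c2 : 'M[F]_(2 + (2 + 2), 2) := stack3 0 1%:M 0.
pose c3 : 'M[F]_(2 + (2 + 2), 2) := stack3 0 0 1%:M.
case/or3P: un; [apply: (key _ _ c1 1%:M) | apply: (key _ _ c2 1%:M)
  | apply: (key _ _ c3 1%:M)];
by rewrite mulmx1 /stack3 !mul_row_col ?mulmx0 ?mulmx1 ?add0r ?addr0.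
Qed.

Let spanned (W : 'M[F]_(2 + (2 + 2))) : Prop :=
  [\/ W = 0, exists e, (W :=: V e)%MS,
      \rank W = 4 /\ (exists2 n, n \in q_good_normals & W *m N n = 0)
    | \rank W = 6].

Let pairP e f : e <> f ->
  (exists2 n, n \in q_good_normals
     & q_dot n (q_block e) = q0 /\ q_dot n (q_block f) = q0) /\
  (exists2 n, n \in q_good_normals
     & q_dot n (q_block e) = q0 /\ qunit (q_dot n (q_block f))).
Proof.
apply: q_pair_okP.
by have /allP/(_ e (mem_qnfs e))/allP/(_ f (mem_qnfs f)) := q_pairs_ok.
Qed.

Let VN_good e n : n \in q_good_normals ->
  V e *m N n = 0 \/ \rank (V e *m N n) = 2.
Proof.
rewrite mem_filter => /andP[/andP[_ /allP/(_ e (mem_qnfs e))/orP[/eqP h|h]] _].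
  by left; apply: VN0.
by right; apply: VN1.
Qed.

Let rk_add_ge (m1 m2 : nat) (A : 'M[F]_(m1, 2 + (2 + 2)))
    (B : 'M[F]_(m2, 2 + (2 + 2))) n :
  B *m N n = 0 -> (\rank (A *m N n) + \rank B <= \rank (A + B)%MS)%N.
Proof.
move=> BN; rewrite -(mxrank_mul_ker (A + B)%MS (N n)); apply: leq_add.
  by apply/mxrankS/submxMr/addsmxSl.
by apply: mxrankS; rewrite sub_capmx addsmxSr; apply/sub_kermxP.
Qed.

Let rkV e : \rank (V e) = 2.
Proof.
apply/eqP; rewrite eqn_leq rkV_le /=.
have [f fe] : exists f, f <> e.
  by case: e; try (by exists P1); exists P2.
have [_ [n _ [_ /VN1 VN]]] := pairP fe.
by have := mxrankM_maxl (V e) (N n); rewrite VN.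
Qed.

Let spanned_add e W : spanned W -> spanned (V e + W)%MS.
Proof.
case=> [->|[f Wf]|[rkW [n n_ok WN]]|rkW].
- by constructor 2; exists e; apply: adds0mx_id || apply: addsmx0.
- case/boolP: (qnf_eqb e f) => [/qnf_eqbP ef|nef].
    by constructor 2; exists f; rewrite ef; apply/eqmxP; rewrite addsmxSl addsmx_sub Wf submx_refl.
  have fe : f <> e by move=> h; move: nef; rewrite h; case: (e) => [|||[[] []]|[[] []]|[[] []]|].
  have [[n n_ok [nf ne]] [m m_ok [mf me]]] := pairP fe.
  constructor 3; split; last first.
    exists n => //; apply/sub_kermxP; rewrite addsmx_sub Wf.
    by apply/andP; split; apply/sub_kermxP; apply: VN0.
  apply/eqP; rewrite eqn_leq; apply/andP; split.
    by apply: leq_trans (mxrank_adds_leqif _ _) _; rewrite Wf !rkV.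
  have WN : W *m N m = 0 by apply/sub_kermxP; rewrite Wf; apply/sub_kermxP/VN0.
  by have := rk_add_ge (V e) WN; rewrite VN1 // Wf rkV.
- have [VN|VN] := VN_good e n_ok.
    constructor 3; have WN' : (V e + W)%MS *m N n = 0.
      by apply/sub_kermxP; rewrite addsmx_sub; apply/andP; split; apply/sub_kermxP.
    split; last by exists n.
    apply/eqP; rewrite eqn_leq -{2}rkW mxrankS ?addsmxSr // andbT.
    have := mxrankS (introT sub_kermxP WN').
    by rewrite mxrank_ker rkN.
  constructor 4; apply/eqP; rewrite eqn_leq rank_leq_col /=.
  by have := rk_add_ge (V e) WN; rewrite VN rkW.
- constructor 4; apply/eqP; rewrite eqn_leq rank_leq_col /=.
  by rewrite -[X in (X <= _)%N]rkW mxrankS // addsmxSr.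
Qed.

Lemma qnf_even (X : {set qnf_elt}) :
  (2 %| block_rank (qnf_block zeta) X)%N.
Proof.
rewrite /block_rank; have: spanned (\sum_(e in X) V e)%MS.
  by apply: big_rec => [|e W _ /(spanned_add e)//]; constructor.
by case=> [->|[e ->]|[-> _]|->]; rewrite ?mxrank0 ?rkV.
Qed.

End QnfEven.

Section Qnf.
Variables (F : finFieldType) (zeta : F).
Hypothesis cardF : #|F| = 49%N.
Hypothesis zeta_prim : 4.-primitive_root zeta.

Lemma pchar_card49 : 7%N \in [pchar F].
Proof. exact: (@card_finPcharP F 7 2). Qed.

Lemma sqr_primitive4 : zeta ^+ 2 = -1.
Proof.
have /eqP : (zeta ^+ 2) ^+ 2 = 1 by rewrite -exprM prim_expr_order.
by rewrite sqrf_eq1 -(prim_order_dvd zeta_prim) => /orP[|/eqP].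
Qed.

Definition qnf_dvd (X : {set qnf_elt}) :
    (2 %| block_rank (qnf_block zeta) X)%N :=
  qnf_even sqr_primitive4 pchar_card49 X.

Definition qnf : matroid qnf_elt := block_matroid (ltn0Sn 1) qnf_dvd.

End Qnf.

(* Main.v *)
Require Import Defs.
From HB Require Import structures.
From mathcomp Require Import all_boot all_order all_algebra all_field.
From mathcomp.multinomials Require Import mpoly.
From mathcomp Require Import boolp.
From mathcomp Require Import ring zify.

(* Let p be the characteristic exponent of F. If the elements pi(e) are raised
   to suitable powers p^(n_e), they become separable over the subring generated
   by a (twisted) transcendence basis, so the coordinate derivations extend to
   all of them, and the differentials d(e) in F^3 satisfy: d(e) is nonzero, and
   dependent triples of M have dependent differentials. The exponents of the
   basis can moreover be chosen so that two prescribed lines (b0, b1, u) and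
   (b1, b2, v) keep their generic position; no perfect closure of K is needed,
   because the basis may be twisted by as large a common power as one likes.
   In this weak linear image of Q_3^NF(Q_8) the quotients of the coordinates of
   the g^(i) give a homomorphism from Q_8 to F^*, which is trivial at the
   commutator -e, whereas the lines through O force its value there to be -1:
   hence 2 = 0 in F. In the image of R_7 the points (0,1,m) have slopes in
   arithmetic progression that close up after 7 steps: hence 7 = 0 in F. *)

Set Implicit Arguments.
Unset Strict Implicit.
Unset Printing Implicit Defensive.
Import GRing.Theory.
Local Open Scope ring_scope.

(** * Algebraic closure and Steinitz exchange *)

(** The obstacle is inseparability: a derivation kills p-th powers, so a relation differentiates
    only in those variables whose exponents agree with the chosen twist. Raising a relation to the
    power p^n shifts all its exponents equally, so a line through two basis elements prescribes the
    difference of their exponents. The lines b0 b1 and b1 b2 impose two such conditions on three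
    exponents and are always compatible; a line b0 b2 could contradict them. All other nonvanishing
    must therefore be recovered from vanishing determinants: for Q_8 a zero coordinate at g spreads
    to g^2 and then to g^4 = e, where it is excluded; for R_7 it is gained along the progression of
    slopes. Derivations are relations on F because their domains are subrings enlarged by one
    element at a time, so that fraction fields are never formed. The 2-linear world escapes the
    contradiction because the commutator -e may act as the matrix -I, whereas the units of F
    commute; there both summands live in characteristic 7. *)

Section Closure.
Variables (K F : fieldType) (iota : {rmorphism K -> F}).
Implicit Types (S T : F -> Prop) (x y : F).

Lemma adjoin_sub_trans S T x :
  (forall s, S s -> adjoin iota T s) -> adjoin iota S x -> adjoin iota T x.
Proof.
move=> ST; elim=> {x} [a|x /ST//|x y _ Tx _ Ty|x y _ Tx _ Ty|x _ Tx].
- exact: adjoin_base.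
- exact: adjoin_sub.
- exact: adjoin_mul.
- exact: adjoin_inv.
Qed.

Lemma adjoin0 S : adjoin iota S 0.
Proof. by rewrite -(rmorph0 iota); apply: adjoin_base. Qed.

Lemma adjoin1 S : adjoin iota S 1.
Proof. by rewrite -(rmorph1 iota); apply: adjoin_base. Qed.

Definition adjoin_pred S : {pred F} := fun x => `[< adjoin iota S x >].

Lemma adjoin_predP S x : reflect (adjoin iota S x) (x \in adjoin_pred S).
Proof. exact: asboolP. Qed.

Lemma adjoin_pred_divring S : divring_closed (adjoin_pred S).
Proof.
split=> [|x y /adjoin_predP Sx /adjoin_predP Sy|x y /adjoin_predP Sx /adjoin_predP Sy]; apply/adjoin_predP.
- exact: adjoin1.
- exact: adjoin_sub.
- by apply: adjoin_mul => //; apply: adjoin_inv.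
Qed.

HB.instance Definition _ S :=
  GRing.isDivringClosed.Build F (adjoin_pred S) (adjoin_pred_divring S).

Definition adjoin_type S := {x : F | x \in adjoin_pred S}.
HB.instance Definition _ S := SubChoice.on (adjoin_type S).
HB.instance Definition _ S := [SubChoice_isSubIntegralDomain of adjoin_type S by <:].
HB.instance Definition _ S := [SubIntegralDomain_isSubField of adjoin_type S by <:].

Definition alg_cl S x := algebraic_over (adjoin iota S) x.

(** Turning K(S) into a field type gives access to the closure of algebraic elements under field
    operations and to transitivity. *)
Lemma clP S x : alg_cl S x <-> algebraicOver (val : adjoin_type S -> F) x.
Proof.
split=> [[p [p0 Sp rp]]|[p p0 rp]].
  pose q : {poly adjoin_type S} := \poly_(i < size p) (insubd (0 : adjoin_type S) p`_i).
  have qE : map_poly val q = p.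
    apply/polyP => i; rewrite coef_map coef_poly.
    case: ltnP => [_|/(nth_default 0)-> //].
    by apply: insubdK; apply/adjoin_predP.
  by exists q; rewrite ?qE // -(map_poly_eq0 (val : adjoin_type S -> F)) qE.
exists (map_poly val p); split=> //; first by rewrite map_poly_eq0.
by move=> i; rewrite coef_map; apply/adjoin_predP/valP.
Qed.

Lemma cl_adjoin S x : adjoin iota S x -> alg_cl S x.
Proof.
move=> Sx; apply/clP; have Sx' : x \in adjoin_pred S by apply/adjoin_predP.
exact: (algebraic_id (val : adjoin_type S -> F) (exist _ x Sx')).
Qed.

Lemma cl_mem S x : S x -> alg_cl S x.
Proof. by move=> Sx; apply/cl_adjoin/adjoin_gen. Qed.

Lemma adjoin_cl S T x : (forall s, T s -> alg_cl S s) -> adjoin iota T x -> alg_cl S x.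
Proof.
move=> TS; elim=> {x} [a|x /TS//|x y _ Sx _ Sy|x y _ Sx _ Sy|x _ Sx].
- exact/cl_adjoin/adjoin_base.
- by apply/clP/algebraic_sub; apply/clP.
- by apply/clP/algebraic_mul; apply/clP.
- by apply/clP/algebraic_inv; apply/clP.
Qed.

Lemma cl_trans S T x : (forall s, T s -> alg_cl S s) -> alg_cl T x -> alg_cl S x.
Proof.
move=> TS [p [p0 Tp rp]]; apply/clP/integral_algebraic.
apply: (integral_root p0 rp); apply/integral_poly => i.
exact/integral_algebraic/clP/(adjoin_cl TS).
Qed.

Lemma cl_mono S T x : (forall s, T s -> S s) -> alg_cl T x -> alg_cl S x.
Proof. by move=> TS; apply: cl_trans => s /TS/cl_mem. Qed.

Definition add1 S x : F -> Prop := fun s => S s \/ s = x.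

Section Fractions.
Variables (A : comNzRingType) (psi : {rmorphism A -> F}) (G : A -> Prop).
Variable S : F -> Prop.
Hypothesis G1 : G 1.
Hypothesis GB : forall f g, G f -> G g -> G (f - g).
Hypothesis GM : forall f g, G f -> G g -> G (f * g).
Hypothesis Giota : forall a, exists2 f, G f & psi f = iota a.
Hypothesis GS : forall x, S x -> exists2 f, G f & psi f = x.

(** [G] is a subring of [A] whose image contains K and S, hence yields all of K(S) as fractions. It
    is used for univariate polynomials evaluated at a point, and for multivariate ones that become
    constant when all variables but one are specialised. *)
Lemma adjoin_frac u : adjoin iota S u ->
  exists f h, [/\ G f, G h, psi h != 0 & u * psi h = psi f].
Proof.
elim=> {u} [a|u /GS[f Gf <-]|u v _ [f [h [fS hS h0 fE]]] _ [f' [h' [fS' hS' h0' fE']]]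
  |u v _ [f [h [fS hS h0 fE]]] _ [f' [h' [fS' hS' h0' fE']]]
  |u _ [f [h [fS hS h0 fE]]]].
- have [f Gf <-] := Giota a.
  by exists f, 1; rewrite rmorph1 mulr1 oner_eq0.
- by exists f, 1; rewrite rmorph1 mulr1 oner_eq0.
- exists (f * h' - f' * h), (h * h'); split; try by [apply: GM | apply: GB; apply: GM].
    by rewrite rmorphM mulf_neq0.
  by rewrite rmorphB !rmorphM /= -fE -fE'; ring.
- exists (f * f'), (h * h'); split; try by apply: GM.
    by rewrite rmorphM mulf_neq0.
  by rewrite !rmorphM /= -fE -fE'; ring.
- have [u0|u0] := eqVneq u 0.
    exists 0, 1; rewrite rmorph0 rmorph1 u0 invr0 mul0r oner_eq0; split=> //.
    by rewrite -(subrr 1); apply: GB.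
  by exists h, f; rewrite -fE mulf_neq0 //; split=> //; rewrite mulKf.
Qed.

Lemma common_denom n (c : nat -> F) : (forall i, adjoin iota S (c i)) ->
  exists (D : A) (q : nat -> A), [/\ psi D != 0, forall i, G (q i)
    & forall i, (i < n)%N -> psi D * c i = psi (q i)].
Proof.
move=> cS; suff [D [q [D0 DS qS qE]]] : exists (D : A) (q : nat -> A),
    [/\ psi D != 0, G D, forall i, G (q i)
      & forall i, (i < n)%N -> psi D * c i = psi (q i)] by exists D, q.
elim: n => [|n [D [q [D0 DS qS qE]]]].
  by exists 1, (fun=> 1); rewrite rmorph1 oner_eq0.
have [f [h [fS hS h0 e]]] := adjoin_frac (cS n).
exists (D * h), (fun i => if i == n then D * f else q i * h); split=> [|||i].
- by rewrite rmorphM mulf_neq0.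
- exact: GM.
- by move=> i; case: ifP => _; apply: GM.
rewrite ltnS leq_eqVlt; case: eqP => [-> _|_ /= /qE qi]; rewrite !rmorphM /=.
  by rewrite -e; ring.
by rewrite -qi; ring.
Qed.

End Fractions.

Lemma cl_exchange S x y : alg_cl (add1 S x) y -> alg_cl S y \/ alg_cl (add1 S y) x.
Proof.
move=> [p [p0 Sp /rootP rp]].
have [|||||D [q [D0 qS qE]]] := @common_denom _ (horner_eval x)
    (fun f => f \is a polyOver (adjoin_pred S)) (add1 S x) _ _ _ _ _ (size p) _ Sp.
- exact: rpred1.
- by move=> f g fS gS; apply: rpredB.
- by move=> f g fS gS; apply: rpredM.
- move=> a; exists (iota a)%:P; last by rewrite /= /horner_eval hornerC.
  by rewrite polyOverC; apply/adjoin_predP/adjoin_base.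
- move=> s [Ss|->]; last first.
    by exists 'X; [apply: polyOverX | rewrite /= /horner_eval hornerX].
  exists s%:P; last by rewrite /= /horner_eval hornerC.
  by rewrite polyOverC; apply/adjoin_predP/adjoin_gen.
(* Q(X, Y) has coefficients in K(S) and satisfies Q(x, Y) = D(x) p(Y), so Q(x, y) = 0. If Q(X, y) is
   nonzero, it makes x algebraic over K(S, y). Otherwise the coefficient of each power of X is a
   polynomial in Y vanishing at y, and one of these is nonzero. *)
pose Q : {poly {poly F}} := \poly_(i < size p) q i.
have QE i : Q`_i = if (i < size p)%N then q i else 0 by rewrite coef_poly.
have QS i : Q`_i \is a polyOver (adjoin_pred S) by rewrite QE; case: ifP; rewrite ?rpred0.
have Qx : map_poly (horner_eval x) Q = D.[x] *: p.
  apply/polyP => i; rewrite coef_map coefZ QE.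
  case: ltnP => [/qE->//|h]; by rewrite (nth_default _ h) mulr0 raddf0.
have Qxy : Q.[y%:P].[x] = 0.
  rewrite -[LHS]/(horner_eval x _) -horner_map Qx /= /horner_eval hornerC.
  by rewrite hornerZ rp mulr0.
have [Qy|Qy] := eqVneq Q.[y%:P] 0; last first.
  right; exists Q.[y%:P]; split=> // [i|]; last exact/rootP.
  apply/adjoin_predP; move: i; apply/polyOverP; rewrite horner_coef rpred_sum // => i _.
  rewrite rpredM ?rpredX ?polyOverC //; last by apply/adjoin_predP/adjoin_gen; right.
  apply/polyOverP => j; apply/adjoin_predP; apply: (@adjoin_sub_trans S).
    by move=> s Ss; apply: adjoin_gen; left.
  by apply/adjoin_predP; move: j; apply/polyOverP.
left; have Q0 : Q != 0.
  apply: contraNneq p0 => Q0; move: Qx; rewrite Q0 rmorph0 => /esym/eqP.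
  by rewrite scaler_eq0 (negPf D0).
have [j rj] : exists j, map_poly (coefp j) Q != 0.
  exists (size (lead_coef Q)).-1; apply: contra_neq (Q0) => e.
  apply/eqP; rewrite -lead_coef_eq0 -lead_coef_eq0; apply/eqP.
  by move/polyP/(_ (size Q).-1): e; rewrite coef0 coef_map.
exists (map_poly (coefp j) Q); split=> // [i|].
  rewrite coef_map /=; apply/adjoin_predP.
  by have /polyOverP := QS i.
apply/rootP; have /polyP/(_ j) := Qy; rewrite coef0 => <-.
rewrite [in RHS]horner_coef coef_sum (@horner_coef_wide _ (size Q)) ?size_poly //.
by apply: eq_bigr => i _; rewrite coef_map /= -rmorphXn coefMC.
Qed.

Definition mem_of (s : seq F) : F -> Prop := fun x => x \in s.

(* In the induction on [a], [c] is the part already exchanged into the spanning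
   list. *)
Lemma steinitz (a b c : seq F) :
  (forall i, (i < size a)%N -> ~ alg_cl (mem_of (c ++ take i a)) a`_i) ->
  (forall x, x \in a -> alg_cl (mem_of (c ++ b)) x) -> (size a <= size b)%N.
Proof.
elim: a b c => // x a IH b c indep span.
(* y is the first element of b whose addition makes x algebraic; by exchange, x can replace it. *)
have [b1 [y [b2 [eb xin xnot]]]] : exists b1 y b2, [/\ b = b1 ++ y :: b2,
    alg_cl (mem_of (c ++ rcons b1 y)) x & ~ alg_cl (mem_of (c ++ b1)) x].
  have := span x (mem_head _ _); have := indep 0 (ltn0Sn _).
  rewrite /= cats0; clear indep span IH; elim: b c => [c|y b IH c] nc.
    by rewrite cats0.
  case: (EM (alg_cl (mem_of (rcons c y)) x)) => [cy _|ncy].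
    by exists [::], y, b; rewrite /= cats0 cats1.
  rewrite -cat_rcons => /(IH _ ncy)[b1 [z [b2 [-> h1 h2]]]].
  by exists (y :: b1), z, b2; rewrite -!cat_rcons.
rewrite {}eb in span *; rewrite size_cat /= addnS ltnS -size_cat.
apply: (IH _ (rcons c x)) => [i lti|z za].
  by rewrite cat_rcons; apply: (indep i.+1).
apply: cl_trans (span z _); last by rewrite inE za orbT.
move=> s; rewrite /mem_of mem_cat mem_cat inE => sin.
have [->|sy] := eqVneq s y; last first.
  apply: cl_mem; rewrite /mem_of !(mem_cat, mem_rcons, inE).
  by move: sin; rewrite (negPf sy) orFb => /or3P[] ->; rewrite ?orbT.
have : alg_cl (add1 (mem_of (c ++ b1)) y) x.
  apply: cl_mono xin => t; rewrite /mem_of /add1 !(mem_cat, mem_rcons, inE).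
  by move=> /or3P[->|/eqP->|->]; rewrite ?orbT; [left|right|left].
case/cl_exchange => [//|]; apply: cl_mono => t.
rewrite /mem_of /add1 !(mem_cat, mem_rcons, inE).
by case=> [/orP[->|->]|->]; rewrite ?eqxx ?orbT.
Qed.


Definition mp_eval m (w : 'I_m -> F) : {mpoly K[m]} -> F := mmap iota w.
HB.instance Definition _ m (w : 'I_m -> F) := GRing.RMorphism.on (mp_eval w).

Lemma cl_mpoly m (w : 'I_m -> F) (i : 'I_m) :
  alg_cl (fun x => exists2 j, j != i & x = w j) (w i) ->
  exists2 P : {mpoly K[m]}, P != 0 & mp_eval w P = 0.
Proof.
move=> [p [p0 Sp /rootP rp]].
(* Only the i-th variable stays free. Clearing denominators with numerators of constant image under
   [th] gives P with [th P] a nonzero multiple of p, so P cannot be zero. *)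
pose h j : {poly F} := if j == i then 'X else (w j)%:P.
pose th : {rmorphism {mpoly K[m]} -> {poly F}} := mmap (polyC \o iota) h.
have thE P : (th P).[w i] = mp_eval w P.
  rewrite /th /mp_eval /= /mmap horner_sum; apply: eq_bigr => mm _.
  rewrite hornerM hornerC /mmap1 horner_prod; congr (_ * _).
  apply: eq_bigr => j _; rewrite horner_exp /h.
  by case: eqP => [->|_]; rewrite !hornerE.
have [|||||D [q [D0 qG qE]]] := @common_denom _ (mp_eval w)
    (fun P => th P = (mp_eval w P)%:P) (fun x => exists2 j, j != i & x = w j)
    _ _ _ _ _ (size p) _ Sp.
- by rewrite !rmorph1.
- by move=> f g fG gG; rewrite !rmorphB /= fG gG.
- by move=> f g fG gG; rewrite !rmorphM /= fG gG.
- by move=> a; exists a%:MP; rewrite /th /= /mp_eval !mmapC.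
- move=> x [j ji ->]; exists 'X_j; rewrite /th /= /mp_eval !mmapX !mmap1U //.
  by rewrite /h (negPf ji).
pose P := \sum_(k < size p) q k * 'X_i ^+ k.
have thP : th P = mp_eval w D *: p.
  rewrite rmorph_sum -[in RHS](coefK p) poly_def scaler_sumr.
  apply: eq_bigr => k _; rewrite rmorphM rmorphXn /= qG mmapX mmap1U /h eqxx.
  by rewrite -qE // scalerA mul_polyC.
exists P; last by rewrite -thE thP hornerZ rp mulr0.
apply: contraNneq p0 => P0; move: thP; rewrite P0 rmorph0 => /esym/eqP.
by rewrite scaler_eq0 (negPf D0).
Qed.

Lemma trdeg_le S n (l : seq F) : trdeg_is iota (adjoin iota S) n ->
  (forall x, S x -> alg_cl (mem_of l) x) -> (n <= size l)%N.
Proof.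
move=> [b [bS bind _]] Sl.
rewrite -(size_tuple b); apply: (@steinitz b l [::]) => [i|x /bS bx].
  rewrite /= size_tuple => lti clb.
  have [|P P0 Pb] := @cl_mpoly _ (tnth b) (Ordinal lti).
    rewrite (tnth_nth 0) /=; apply: cl_mono clb => x /(nthP 0)[j].
    rewrite size_take size_tuple lti => ltj <-.
    have ltjn : (j < n)%N by apply: ltn_trans lti.
    exists (Ordinal ltjn); first by rewrite -val_eqE /= neq_ltn ltj.
    by rewrite nth_take // (tnth_nth 0).
  by move/bind: Pb P0 => ->; rewrite eqxx.
exact: adjoin_cl bx.
Qed.

Lemma trdeg_ge S n (l : seq F) : trdeg_is iota (adjoin iota S) n ->
  (forall x, x \in l -> S x) -> (n < size l)%N ->
  exists2 i, (i < size l)%N & alg_cl (mem_of (take i l)) l`_i.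
Proof.
move=> [b [bS _ Sb]] lS ltn; apply: contrapT => /forall2NP nex.
suff : (size l <= size b)%N by rewrite size_tuple leqNgt ltn.
apply: (@steinitz l b [::]) => [i lti|x /lS Sx /=]; last first.
  exact/Sb/adjoin_gen.
by case: (nex i).
Qed.

End Closure.

(** * Polynomial relations with nonvanishing derivatives *)

(* Exponential characteristic: [p = 1] in characteristic zero. *)
Definition expchar (R : nzRingType) (p : nat) : Prop :=
  (p = 1%N /\ [pchar R] =i pred0) \/ p \in [pchar R].

Lemma expchar_exists (R : fieldType) : exists p, expchar R p.
Proof.
case: (EM (exists p, p \in [pchar R])) => [[p Rp]|nR]; first by exists p; right.
exists 1%N; left; split=> // p; apply/negP => Rp.
by case: nR; exists p.
Qed.

Lemma expchar_rmorph (R R' : fieldType) (f : {rmorphism R -> R'}) p :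
  expchar R p -> expchar R' p.
Proof.
case=> [[-> R0]|Rp]; [left; split=> // q|right].
  by rewrite (fmorph_pchar f).
by rewrite (fmorph_pchar f).
Qed.

Lemma expchar_gt0 (R : fieldType) p : expchar R p -> (0 < p)%N.
Proof. by case=> [[->]|/pcharf_prime/prime_gt0]. Qed.

Lemma frobenius_rmorph (R : fieldType) p n : expchar R p ->
  exists f : {rmorphism R -> R}, forall x, f x = x ^+ (p ^ n).
Proof.
case=> [[-> _]|Rp]; first by exists idfun => x; rewrite exp1n expr1.
elim: n => [|n [f fE]]; first by exists idfun => x; rewrite expn0 expr1.
exists (pFrobenius_aut Rp \o f) => x /=.
by rewrite pFrobenius_autE fE -exprM -expnSr.
Qed.

Section MinimalRelation.
Variables (K F : fieldType) (iota : {rmorphism K -> F}) (p : nat).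
Hypothesis Kp : expchar K p.

Definition occurs m (P : {mpoly K[m]}) (i : 'I_m) : bool :=
  has (fun mm : 'X_{1..m} => mm i != 0%N) (msupp P).

Definition frob_pow m (w : 'I_m -> F) (a : 'I_m -> nat) i : F := w i ^+ (p ^ a i).

Definition mp_degree m (P : {mpoly K[m]}) (i : 'I_m) : nat :=
  \max_(mm <- msupp P) (mm : 'X_{1..m}) i.

Lemma mp_degree_ge m (P : {mpoly K[m]}) mm :
  mm \in msupp P -> forall i, (mm i <= mp_degree P i)%N.
Proof. by move=> mP i; apply: (@leq_bigmax_seq _ _ _ (fun mm : 'X_{1..m} => mm i)). Qed.

Lemma mp_degree_le m (P : {mpoly K[m]}) i k :
  (forall mm, mm \in msupp P -> (mm i <= k)%N) -> (mp_degree P i <= k)%N.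
Proof. by move=> h; apply/bigmax_leqP_seq => mm mP _; apply: h. Qed.

Lemma occurs_degree m (P : {mpoly K[m]}) i : occurs P i -> (0 < mp_degree P i)%N.
Proof. by case/hasP => mm /mp_degree_ge/(_ i) h; rewrite -lt0n => /leq_trans; apply. Qed.

Definition contract m (P : {mpoly K[m]}) i : {mpoly K[m]} :=
  \sum_(mm <- msupp P) P@_mm *:
     'X_[[multinom (if j == i then mm j %/ p else mm j)%N | j < m]].

Definition degree_sum m (P : {mpoly K[m]}) := (\sum_i mp_degree P i)%N.

Lemma degree_sum_lt m (P Q : {mpoly K[m]}) i : (forall j, mp_degree Q j <= mp_degree P j)%N ->
  (mp_degree Q i < mp_degree P i)%N -> (degree_sum Q < degree_sum P)%N.
Proof.
move=> le lt; rewrite /degree_sum (bigD1 i) //= [X in (_ < X)%N](bigD1 i) //=.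
by rewrite -addSn leq_add // leq_sum.
Qed.

Lemma degree_sum_mderiv m (P : {mpoly K[m]}) i :
  P^`M(i) != 0 -> (degree_sum P^`M(i) < degree_sum P)%N.
Proof.
have supp mm : mm \in msupp P^`M(i) -> (mm + U_(i))%MM \in msupp P.
  by rewrite !mcoeff_msupp mcoeff_deriv; apply: contraNneq => ->; rewrite mul0rn.
move=> P0; apply: (@degree_sum_lt _ _ _ i) => [j|].
  apply: mp_degree_le => mm /supp/mp_degree_ge/(_ j); rewrite mnmDE; apply: leq_trans.
  exact: leq_addr.
have [mm mP] : exists mm, mm \in msupp P^`M(i).
  move: P0; rewrite -msupp_eq0; case: (msupp _) => // mm s _.
  by exists mm; apply: mem_head.
have : (0 < mp_degree P i)%N.
  by apply: leq_trans (mp_degree_ge (supp _ mP) i); rewrite mnmDE mnm1E eqxx addn1.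
case e : (mp_degree P i) => [//|k] _; rewrite ltnS; apply: mp_degree_le => nn /supp/mp_degree_ge.
by move/(_ i); rewrite e mnmDE mnm1E eqxx addn1.
Qed.

Lemma mderiv0_dvd m (P : {mpoly K[m]}) i mm :
  P^`M(i) = 0 -> mm \in msupp P -> mm i = 0%N \/ p \in [pchar K] /\ (p %| mm i)%N.
Proof.
move=> P0 mP; case: (posnP (mm i)) => [|mi]; first by left.
right; have mi0 : (mm i)%:R = 0 :> K.
  have /mpolyP/(_ (mm - U_(i))%MM) := P0; rewrite mcoeff0 mcoeff_deriv.
  rewrite mnmBE mnm1E eqxx subn1 prednK // submK; last first.
    by apply/mnm_lepP => j; rewrite mnm1E; case: eqP => // <-.
  move: mP; rewrite mcoeff_msupp => /negPf P0'.
  by move=> /eqP; rewrite -(mulr_natr P@_mm) mulf_eq0 P0' => /eqP.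
have Kp' : p \in [pchar K].
  case: Kp => // -[_ /pcharf0P/(_ (mm i))]; rewrite mi0 eqxx => /esym/eqP e.
  by rewrite e in mi.
by split=> //; rewrite (dvdn_pcharf Kp') mi0.
Qed.

(** With zero derivative in X_i, all exponents of X_i are multiples of p. Dividing them by p merges
    no monomials, so no coefficients cancel, and it lowers the degree: an occurring X_i excludes
    characteristic zero, so p > 1. *)
Lemma contract_spec m (P : {mpoly K[m]}) i (w : 'I_m -> F) :
  P != 0 -> P^`M(i) = 0 -> occurs P i ->
  [/\ contract P i != 0, (degree_sum (contract P i) < degree_sum P)%N
    & mp_eval iota (fun j => if j == i then w j ^+ p else w j) (contract P i)
      = mp_eval iota w P].
Proof.
move=> P0 dP oi; have Kp' : p \in [pchar K].
  case/hasP: oi => mm mP; case: (mderiv0_dvd dP mP) => [->//|[]//].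
have pdvd mm : mm \in msupp P -> (p %| mm i)%N.
  by move/(mderiv0_dvd dP) => [->|[]].
pose c (mm : 'X_{1..m}) : 'X_{1..m} :=
  [multinom (if j == i then mm j %/ p else mm j)%N | j < m].
have cE mm j : c mm j = (if j == i then mm j %/ p else mm j)%N by rewrite mnmE.
have cinj mm nn : mm \in msupp P -> nn \in msupp P -> c mm = c nn -> mm = nn.
  move=> /pdvd mP /pdvd nP e; apply/mnmP => j; have := congr1 (fun x : 'X_{1..m} => x j) e.
  rewrite !cE; case: eqP => // -> e'.
  by rewrite -(divnK mP) e' divnK.
have coef mm : mm \in msupp P -> (contract P i)@_(c mm) = P@_mm.
  move=> mP; rewrite /contract raddf_sum (bigD1_seq mm) ?msupp_uniq //= mcoeffZ.
  rewrite mcoeffX eqxx mulr1 big_seq_cond big1 ?addr0 // => nn /andP[nP nm].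
  rewrite mcoeffZ mcoeffX; case: eqP => [/(cinj _ _ nP mP)|]; last by rewrite mulr0.
  by move=> e; rewrite e eqxx in nm.
have suppc nn : nn \in msupp (contract P i) -> exists2 mm, mm \in msupp P & nn = c mm.
  move=> nP; apply: contrapT => nex; move: nP; rewrite mcoeff_msupp /contract.
  rewrite raddf_sum big_seq big1 ?eqxx // => mm mP.
  rewrite /= mcoeffZ mcoeffX; case: eqP => [e|]; last by rewrite mulr0.
  by case: nex; exists mm.
have [m0 m0P] : exists mm, mm \in msupp P.
  by case/hasP: oi => mm; exists mm.
have p1 := prime_gt1 (pcharf_prime Kp').
split.
- by apply/eqP => c0; move: (m0P); rewrite mcoeff_msupp -(coef _ m0P) c0 mcoeff0 eqxx.
- apply: (@degree_sum_lt _ _ _ i) => [j|].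
    apply: mp_degree_le => nn /suppc[mm mP ->]; apply: leq_trans (mp_degree_ge mP j).
    by rewrite cE; case: eqP => // _; apply: leq_div.
  apply: (@leq_ltn_trans (mp_degree P i %/ p)).
    apply: mp_degree_le => nn /suppc[mm mP ->]; rewrite cE eqxx.
    by apply: leq_div2r; apply: mp_degree_ge.
  by rewrite ltn_Pdiv // occurs_degree.
- rewrite /mp_eval /contract raddf_sum /= [RHS]/mmap big_seq [RHS]big_seq.
  apply: eq_bigr => mm mP; rewrite mmapZ mmapX; congr (_ * _).
  apply: eq_bigr => j _; rewrite mnmE; case: eqP => [->|//].
  by rewrite -exprM mulnC divnK ?pdvd.
Qed.

(** Descent on the sum of the partial degrees. If X_i occurs and its derivative vanishes at w,
    either this derivative is a smaller relation, or it is the zero polynomial and X_i^p becomes a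
    new variable with value w_i^p. The latter moves produce the exponents [a]. *)
Lemma minimal_relation m (w : 'I_m -> F) (P : {mpoly K[m]}) :
  P != 0 -> mp_eval iota w P = 0 -> exists a (Q : {mpoly K[m]}),
    [/\ Q != 0, mp_eval iota (frob_pow w a) Q = 0
      & forall i, occurs Q i -> mp_eval iota (frob_pow w a) Q^`M(i) != 0].
Proof.
have [n] := ubnP (degree_sum P); elim: n w P => // n IH w P; rewrite ltnS => lePn P0 Pw.
case: (EM (exists i, occurs P i /\ mp_eval iota w P^`M(i) = 0)) => [[i [oi dPw]]|nex].
  have [dP|dP] := eqVneq P^`M(i) 0; last first.
    by apply: (IH _ _ _ dP dPw); apply: leq_trans (degree_sum_mderiv dP) lePn.
  have [c0 ltc cw] := contract_spec w P0 dP oi.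
  move: cw; rewrite Pw => cw.
  have [a [Q [Q0 Qw dQ]]] := IH _ _ (leq_trans ltc lePn) c0 cw.
  exists (fun j => (j == i) + a j)%N, Q.
  have -> : frob_pow w (fun j => (j == i) + a j)%N =
    frob_pow (fun j => if j == i then w j ^+ p else w j) a.
    apply/funext => j; rewrite /frob_pow; case: eqP => _ //.
    by rewrite expnD expn1 exprM.
  by split.
exists (fun=> 0%N), P; have -> : frob_pow w (fun=> 0%N) = w.
  by apply/funext => j; rewrite /frob_pow expn0 expr1.
split=> // i oi; apply/eqP => e; apply: nex; by exists i.
Qed.

End MinimalRelation.

(** * Derivations as subrings of the dual numbers *)

(* [D x v] reads "the derivation D is defined at x, with value v": the graph is
   a subring of the dual numbers A[eps]. *)
Record dual_subring (A : comNzRingType) (D : A -> A -> Prop) : Prop := DualSubring {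
  dual1 : D 1 0;
  dualB : forall x v y w, D x v -> D y w -> D (x - y) (v - w);
  dualM : forall x v y w, D x v -> D y w -> D (x * y) (x * w + v * y)
}.

Section DualSubring.
Variables (A : comNzRingType) (D : A -> A -> Prop).
Hypothesis HD : dual_subring D.

Lemma dual0 : D 0 0.
Proof. by have := dualB HD (dual1 HD) (dual1 HD); rewrite !subrr. Qed.

Lemma dualN x v : D x v -> D (- x) (- v).
Proof. by move=> /(dualB HD dual0); rewrite !sub0r. Qed.

Lemma dualD x v y w : D x v -> D y w -> D (x + y) (v + w).
Proof. by move=> Dx /dualN/(dualB HD Dx); rewrite !opprK. Qed.

Lemma dual_sum (I : Type) (r : seq I) (P : pred I) (f g : I -> A) :
  (forall i, P i -> D (f i) (g i)) ->
  D (\sum_(i <- r | P i) f i) (\sum_(i <- r | P i) g i).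
Proof.
by move=> fg; apply: (big_ind2 D) => //; [apply: dual0 | move=> *; apply: dualD].
Qed.

Lemma dualX x v n : D x v -> D (x ^+ n) (v * x ^+ n.-1 *+ n).
Proof.
move=> Dx; elim: n => [|n IH]; first by rewrite mulr0n; apply: dual1.
have := dualM HD Dx IH; rewrite -exprS; congr (D _ _).
case: n {IH} => [|n]; first by rewrite mulr0n mulr0 add0r.
by rewrite /= exprS mulrS -mulrnAr; ring.
Qed.

(** Any further p-th power has derivative 0, while for p = 1 every twist is trivial. This case
    distinction later decides which variables survive differentiation. *)
Lemma dual_frobenius p e k t v : expchar A p -> (e <= k)%N ->
  D (t ^+ (p ^ e)) v ->
  D (t ^+ (p ^ k)) (if (p == 1%N) || (k == e) then v else 0).
Proof.
move=> [[-> _]|Ap] lek Dt; first by move: Dt; rewrite !exp1n eqxx.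
have p1 := prime_gt1 (pcharf_prime Ap).
case: eqP => [e1|_]; first by rewrite e1 in p1.
case: eqP => [->//|/eqP ke] /=.
have [n ->] : exists n, k = (e + n.+1)%N.
  by exists (k - e).-1; rewrite prednK ?subnKC // subn_gt0 ltn_neqAle eq_sym ke.
have := dualX (p ^ n.+1) Dt; rewrite -exprM -expnD.
by rewrite -mulr_natr natrX pcharf0 // expr0n mulr0.
Qed.

Lemma dual_mpoly (K : comNzRingType) (psi : {rmorphism K -> A}) m
    (w d : 'I_m -> A) (P : {mpoly K[m]}) :
  (forall a, D (psi a) 0) -> (forall i, D (w i) (d i)) ->
  D (mmap psi w P) (\sum_i mmap psi w P^`M(i) * d i).
Proof.
move=> Dpsi Dw.
pose good P := D (mmap psi w P) (\sum_i mmap psi w P^`M(i) * d i).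
have goodD P1 P2 : good P1 -> good P2 -> good (P1 + P2).
  move=> g1 g2; have := dualD g1 g2; rewrite /good rmorphD -big_split /=.
  congr (D _ _); apply: eq_bigr => i _.
  by rewrite mderivD rmorphD /= mulrDl.
have goodM P1 P2 : good P1 -> good P2 -> good (P1 * P2).
  move=> g1 g2; have := dualM HD g1 g2; rewrite /good rmorphM /=.
  congr (D _ _); rewrite mulr_sumr mulr_suml -big_split /=.
  by apply: eq_bigr => i _; rewrite mderivM rmorphD !rmorphM /=; ring.
have goodC c : good c%:MP.
  rewrite /good big1 => [|i _]; last by rewrite mderivC rmorph0 mul0r.
  by rewrite mmapC; apply: Dpsi.
have goodX i : good 'X_i.
  rewrite /good mmapX mmap1U (bigD1 i) //= big1 => [|j ji].
    rewrite mderivX mnm1E eqxx scale1r -{1}[U_(i)%MM]add0m addmK mpolyX0 rmorph1 mul1r addr0.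
    exact: Dw.
  by rewrite mderivX mnm1E eq_sym (negPf ji) scale0r rmorph0 mul0r.
rewrite -/(good P) (mpolyE P); apply: big_ind => [||mm _].
- by rewrite -(mpolyC0 m); apply: (goodC).
- exact: goodD.
- rewrite -mul_mpolyC; apply: (goodM) => //; rewrite mpolyXE_id.
  apply: big_ind => [||i _]; [by rewrite -mpolyC1; apply: (goodC)|exact: goodM|].
  elim: (mm i) => [|k IH]; first by rewrite expr0 -mpolyC1; apply: (goodC).
  by rewrite exprS; apply: (goodM).
Qed.

End DualSubring.

(** * Extending a derivation by one separable element *)

Section DualPoly.
Variables (F : fieldType) (D : F -> F -> Prop).
Hypothesis HD : dual_subring D.

Definition dual_poly (h k : {poly F}) : Prop := forall i, D h`_i k`_i.

Lemma dual_polyC x v : D x v -> dual_poly x%:P v%:P.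
Proof. by move=> Dx i; rewrite !coefC; case: eqP => // _; apply: dual0. Qed.

Lemma dual_poly_subring : dual_subring dual_poly.
Proof.
split=> [|h k h' k' Dh Dh' i|h k h' k' Dh Dh' i].
- by rewrite -polyC1 -polyC0; apply: dual_polyC; apply: dual1.
- by rewrite !coefB; apply: dualB.
- rewrite coefD !coefM -big_split /=; apply: dual_sum => // j _.
  exact: dualM.
Qed.

Lemma dual_polyX : dual_poly 'X 0.
Proof.
by move=> i; rewrite coefX coef0; case: eqP => _; [apply: dual1 | apply: dual0].
Qed.

Variables b w : F.

(** The extension of D to the ring generated by b over its domain, with value w at b: k(b) comes
    from the coefficients of h, and h'(b) w from the powers of b. *)
Definition dual_ext (x v : F) : Prop :=
  exists h k, [/\ dual_poly h k, x = h.[b] & v = k.[b] + h^`().[b] * w].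

Lemma dual_ext_subring : dual_subring dual_ext.
Proof.
have HP := dual_poly_subring.
split=> [|x v y u [h [k [Dh -> ->]]] [h' [k' [Dh' -> ->]]]
  |x v y u [h [k [Dh -> ->]]] [h' [k' [Dh' -> ->]]]].
- exists 1, 0; split; first exact: (dual1 HP).
    by rewrite hornerC.
  by rewrite -polyC1 derivC !horner0 mul0r addr0.
- exists (h - h'), (k - k'); split; first exact: (dualB HP).
    by rewrite hornerD hornerN.
  by rewrite derivB !(hornerD, hornerN); ring.
- exists (h * h'), (h * k' + k * h'); split; first exact: (dualM HP).
    by rewrite hornerM.
  by rewrite derivM !(hornerD, hornerM); ring.
Qed.

Lemma dual_ext_sub x v : D x v -> dual_ext x v.
Proof.
move=> Dx; exists x%:P, v%:P; split; first exact: dual_polyC.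
  by rewrite hornerC.
by rewrite derivC horner0 hornerC mul0r addr0.
Qed.

Lemma dual_ext_gen : dual_ext b w.
Proof.
exists 'X, 0; split; first exact: dual_polyX.
  by rewrite hornerX.
by rewrite derivX horner0 hornerC mul1r add0r.
Qed.

Hypothesis D0 : forall v, D 0 v -> v = 0.

(** It must be shown that T(h) = k(b) + h'(b) w vanishes whenever h(b) = 0. The role of the minimal
    polynomial is played by a nonzero G of least size vanishing at b; as the domain of D is only a
    ring, division by G is pseudo-division. It yields c T(h) = r T(G) and c h'(b) = r G'(b) with c
    nonzero. For h = g the second equation makes r nonzero, so T(g) = 0 gives T(G) = 0, and then
    T(h) = 0 for every h. *)
Lemma dual_ext0 g g1 : dual_poly g g1 -> g.[b] = 0 -> g^`().[b] != 0 ->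
  g1.[b] + g^`().[b] * w = 0 -> forall v, dual_ext 0 v -> v = 0.
Proof.
have HP := dual_poly_subring.
move=> Dg gb dgb Tg v [h [k [Dh /esym hb ->]]].
pose T (h k : {poly F}) := k.[b] + h^`().[b] * w.
have DP0 k' : dual_poly 0 k' -> k' = 0.
  by move=> Dk; apply/polyP => i; rewrite coef0; apply: D0; have := Dk i; rewrite coef0.
have [G [G1 [DG Gb G0 Gmin]]] : exists G G1, [/\ dual_poly G G1, G.[b] = 0, G != 0
    & forall h k, dual_poly h k -> h.[b] = 0 -> h != 0 -> (size G <= size h)%N].
  have g0 : g != 0 by apply: contraNneq dgb => ->; rewrite deriv0 horner0.
  have [n] := ubnP (size g); elim: n (g) g1 g0 gb Dg {dgb Tg} => // n IH f f1 f0 fb Df.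
  rewrite ltnS => lefn.
  case: (EM (exists h k, [/\ dual_poly h k, h.[b] = 0, h != 0 & (size h < size f)%N])).
    move=> [f' [k' [Df' fb' f0' lt']]]; apply: (IH f' k') => //.
    exact: leq_trans lt' lefn.
  move=> nex; exists f, f1; split=> // h' k' Dh' hb' h0'.
  rewrite leqNgt; apply/negP => lt; apply: nex; by exists h', k'.
(* pseudo-division of h by G *)
have div h' k' : dual_poly h' k' -> h'.[b] = 0 -> exists c r,
    [/\ c != 0, c * T h' k' = r * T G G1 & c * h'^`().[b] = r * G^`().[b]].
  have [n] := ubnP (size h'); elim: n h' k' => // n IH f f1; rewrite ltnS.
  move=> lefn Df fb; have [f0|f0] := eqVneq f 0.
    exists 1, 0; rewrite oner_eq0 /T; move: Df; rewrite f0 => /DP0 ->.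
    by rewrite deriv0 !horner0 !mul0r add0r !mulr0.
  have leGf := Gmin _ _ Df fb f0.
  pose l : {poly F} := (lead_coef G)%:P; pose l1 : {poly F} := (G1`_(size G).-1)%:P.
  pose q : {poly F} := (lead_coef f)%:P * 'X^(size f - size G).
  pose q1 : {poly F} := (f1`_(size f).-1)%:P * 'X^(size f - size G).
  have Dl : dual_poly l l1 by apply: dual_polyC; apply: DG.
  have DX n' : dual_poly 'X^n' 0.
    by have := dualX HP n' dual_polyX; rewrite mul0r mul0rn.
  have Dq : dual_poly q q1.
    have := dualM HP (dual_polyC (Df (size f).-1)) (DX (size f - size G)%N).
    by rewrite mulr0 add0r.
  pose f' := l * f - q * G.
  have Df' := dualB HP (dualM HP Dl Df) (dualM HP Dq DG).
  have fb' : f'.[b] = 0 by rewrite hornerD hornerN !hornerM fb Gb !mulr0 subr0.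
  have [|c [r [c0 cT cd]]] := IH f' _ _ Df' fb'.
    apply: leq_trans lefn; have sG : (0 < size G)%N by rewrite size_poly_gt0.
    have sf : (0 < size f)%N by rewrite size_poly_gt0.
    have [k1 k2] : (size f - size G <= (size f).-1)%N /\
        ((size f).-1 - (size f - size G) = (size G).-1)%N.
      by move: sG sf leGf; move: (size f) (size G) => sf sG; lia.
    have k3 j : ((size f).-1 < j -> size G <= j - (size f - size G) /\ size f <= j)%N.
      by move: sG sf leGf; move: (size f) (size G) => sf sG; lia.
    apply: (@leq_ltn_trans (size f).-1); last by rewrite prednK.
    apply/leq_sizeP => j lej.
    have lekj := leq_trans k1 lej.
    rewrite coefB coefCM -mulrA coefCM coefXnM ltnNge lekj /=.
    move: lej; rewrite leq_eqVlt => /orP[/eqP <-|ltj].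
      by rewrite k2 /lead_coef mulrC subrr.
    by have [le1 le2] := k3 _ ltj; rewrite !nth_default // !mulr0 subrr.
  exists (c * lead_coef G), (r + c * q.[b]); split.
  - by rewrite mulf_neq0 ?lead_coef_eq0.
  - rewrite mulrDl -cT /T /f' derivB !derivM derivC.
    by rewrite !(hornerD, hornerM, hornerN, hornerC) fb Gb; ring.
  - rewrite mulrDl -cd /f' derivB !derivM derivC.
    by rewrite !(hornerD, hornerM, hornerN, hornerC) fb Gb; ring.
have TG : T G G1 = 0.
  have [c [r [c0 cT cd]]] := div _ _ Dg gb.
  move: cT; rewrite [T g g1]Tg mulr0 => /esym/eqP; rewrite mulf_eq0.
  case: eqP => [r0|_ /eqP//]; move: (mulf_neq0 c0 dgb).
  by rewrite cd r0 mul0r eqxx.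
have [c [r [c0 cT _]]] := div _ _ Dh hb.
by move: cT; rewrite TG mulr0 => /eqP; rewrite mulf_eq0 (negPf c0) => /eqP.
Qed.

End DualPoly.

(** * Extending derivations along relations *)

Section Relations.
Variables (K F : fieldType) (iota : {rmorphism K -> F}) (p : nat).
Hypothesis Kp : expchar K p.
Let Fp : expchar F p := expchar_rmorph iota Kp.
Local Notation ev := (mp_eval iota).

Lemma ev_agree m (P : {mpoly K[m]}) (w w' : 'I_m -> F) :
  (forall i, occurs P i -> w i = w' i) -> ev w P = ev w' P.
Proof.
move=> ww'; rewrite /mp_eval /mmap big_seq [RHS]big_seq; apply: eq_bigr => mm mP.
congr (_ * _); apply: eq_bigr => i _.
have [->|mi] := eqVneq (mm i) 0%N; first by rewrite !expr0.
by rewrite ww' //; apply/hasP; exists mm.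
Qed.

Lemma occurs_mderiv m (P : {mpoly K[m]}) i j : occurs P^`M(j) i -> occurs P i.
Proof.
case/hasP => mm mP mi; apply/hasP; exists (mm + U_(j))%MM.
  by move: mP; rewrite !mcoeff_msupp mcoeff_deriv; apply: contraNneq => ->; rewrite mul0rn.
by rewrite mnmDE addn_eq0 negb_and mi.
Qed.

Lemma horner_mmap m (P : {mpoly K[m]}) (h : 'I_m -> {poly F}) x :
  (mmap (polyC \o iota) h P).[x] = ev (fun j => (h j).[x]) P.
Proof.
rewrite /mp_eval /mmap horner_sum; apply: eq_bigr => mm _.
rewrite hornerM hornerC /mmap1 horner_prod; congr (_ * _).
by apply: eq_bigr => j _; rewrite horner_exp.
Qed.

(* [I] is the set of variables that occur in the relation. *)
Definition reln m (w : 'I_m -> F) (a : 'I_m -> nat) (I : pred 'I_m) : Prop :=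
  exists P : {mpoly K[m]}, [/\ ev (frob_pow p w a) P = 0,
    forall i, occurs P i -> I i & forall i, I i -> ev (frob_pow p w a) P^`M(i) != 0].

Lemma reln_exists m (w : 'I_m -> F) (P : {mpoly K[m]}) : P != 0 -> ev w P = 0 ->
  exists a I, reln w a I /\ exists i, I i.
Proof.
move=> P0 Pw; have [a [Q [Q0 Qw dQ]]] := minimal_relation Kp P0 Pw.
exists a, (occurs Q); split; first by exists Q.
apply: contrapT => nocc.
have QC : Q = (Q@_0%MM)%:MP.
  apply/mpolyP => mm; rewrite mcoeffC.
  have [->|mm0] := eqVneq mm 0%MM; first by rewrite mulr1.
  rewrite mulr0; apply/eqP; rewrite mcoeff_eq0.
  apply: contra mm0 => mQ; apply/eqP/mnmP => i; rewrite mnm0E.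
  apply/eqP; apply: contrapT => mi; apply: nocc; exists i; apply/hasP.
  by exists mm => //; apply/negP.
move: Qw Q0; rewrite QC /mp_eval mmapC => /eqP; rewrite fmorph_eq0 => /eqP ->.
by rewrite mpolyC0 eqxx.
Qed.

(** Frobenius is applied to the whole relation, including its coefficients. Only powers of
    coefficients are taken, never roots, so they stay in K. *)
Lemma reln_shift m (w : 'I_m -> F) a I n :
  reln w a I -> reln w (fun i => a i + n)%N I.
Proof.
move=> [P [Pw oP dP]].
have [f fE] := frobenius_rmorph n Kp; have [g gE] := frobenius_rmorph n Fp.
have evf Q : ev (frob_pow p w (fun i => a i + n)%N) (map_mpoly f Q) = g (ev (frob_pow p w a) Q).
  rewrite /mp_eval /mmap (perm_big _ (msupp_map_mpoly _ (fmorph_inj f))) rmorph_sum.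
  apply: eq_bigr => mm _; rewrite /= mcoeff_map_mpoly rmorphM; congr (_ * _).
    by rewrite gE -rmorphXn; congr (iota _); apply: fE.
  rewrite /mmap1 rmorph_prod; apply: eq_bigr => i _.
  by rewrite rmorphXn gE /frob_pow expnD exprM.
exists (map_mpoly f P); split=> [|i oi|i Ii].
- by rewrite evf Pw rmorph0.
- apply: oP; case/hasP: oi => mm mP mi; apply/hasP; exists mm => //.
  by move: mP; rewrite !mcoeff_msupp mcoeff_map_mpoly fmorph_eq0.
- have -> : (map_mpoly f P)^`M(i) = map_mpoly f P^`M(i).
    apply/mpolyP => mm; rewrite mcoeff_deriv !mcoeff_map_mpoly mcoeff_deriv.
    by symmetry; apply: (rmorphMn f).
  by rewrite evf fmorph_eq0 dP.
Qed.

(** Formal differentiation is itself a dual subring, so the chain rule [dual_mpoly] also computes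
    the derivative of a substituted polynomial. *)
Lemma dual_deriv : dual_subring (fun h k : {poly F} => k = h^`()).
Proof.
split=> [|x v y u -> ->|x v y u -> ->].
- by rewrite -polyC1 derivC.
- by rewrite derivB.
- by rewrite derivM addrC.
Qed.

Lemma reln_sep m (w : 'I_m -> F) a I i (D : F -> F -> Prop) :
  dual_subring D -> (forall c, D (iota c) 0) -> reln w a I -> I i ->
  (forall j, j != i -> I j -> exists v, D (frob_pow p w a j) v) ->
  exists h k, [/\ dual_poly D h k, h.[frob_pow p w a i] = 0 & h^`().[frob_pow p w a i] != 0].
Proof.
move=> HD Dc [P [Pw oP dP]] Ii Dw.
(* Variables outside [I] do not occur in [P]; they are set to 0 because D may be undefined at their
   values. *)
pose h j : {poly F} := if j == i then 'X else if I j then (frob_pow p w a j)%:P else 0.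
have [d dE] : exists d : 'I_m -> {poly F}, forall j, dual_poly D (h j) (d j).
  apply: (@fin_all_exists _ (fun=> {poly F}) (fun j x => dual_poly D (h j) x)) => j.
  rewrite /h; case: ifPn => [_|ji]; first by exists 0; apply: dual_polyX.
  case: ifPn => Ij; last by exists 0; apply: dual0; apply: dual_poly_subring.
  by have [v Dv] := Dw _ ji Ij; exists v%:P; apply: dual_polyC.
have hc c : dual_poly D ((polyC \o iota) c) 0 by apply: (dual_polyC HD (Dc c)).
have ew Q : (forall i, occurs Q i -> occurs P i) ->
    ev (fun j => (h j).[frob_pow p w a i]) Q = ev (frob_pow p w a) Q.
  move=> QP; apply: ev_agree => j /QP/oP Ij; rewrite /h Ij.
  by case: eqP => [->|_]; rewrite ?hornerX ?hornerC.
exists (mmap (polyC \o iota) h P), (\sum_j mmap (polyC \o iota) h P^`M(j) * d j).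
split; first exact: (dual_mpoly (dual_poly_subring HD) P hc dE).
  by rewrite horner_mmap ew.
rewrite -(dual_mpoly dual_deriv (psi := polyC \o iota) (d := fun j => (j == i)%:R)); first last.
- by move=> j; rewrite /h; case: eqP => _; rewrite ?derivX //; case: (I j); rewrite ?derivC ?deriv0.
- by move=> c; rewrite /= derivC.
rewrite (bigD1 i) //= big1 => [|j /negPf ->]; last by rewrite mulr0.
rewrite eqxx mulr1 addr0 horner_mmap ew ?dP // => j; exact: occurs_mderiv.
Qed.

Lemma reln_cl m (w : 'I_m -> F) a I i : reln w a I -> I i ->
  alg_cl iota (fun x => exists2 j, I j && (j != i) & x = w j) (w i).
Proof.
move=> r Ii; set S := fun x => _.
(* With mere membership in K(S) in place of a derivation, [reln_sep] states that the twisted w_i is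
   algebraic over K(S); w_i itself is a p-power root of it. *)
have [||j ji Ij|h [k [Dh hw dhw]]] :=
  @reln_sep _ w a I i (fun x _ => adjoin iota S x) _ _ r Ii.
- split=> [|x _ y _|x _ y _]; [exact: adjoin1|exact: adjoin_sub|exact: adjoin_mul].
- by move=> c; apply: adjoin_base.
- exists 0; rewrite /frob_pow; elim: (p ^ _)%N => [|n IH]; first exact: adjoin1.
  rewrite exprS; apply: adjoin_mul => //; apply: adjoin_gen.
  by exists j; rewrite // Ij.
apply: (@cl_trans _ _ _ _ (fun x => x = frob_pow p w a i)) => [_ ->|].
  exists h; split=> //; last exact/rootP.
  by apply: contraNneq dhw => ->; rewrite deriv0 horner0.
have q0 : (0 < p ^ a i)%N by rewrite expn_gt0 (expchar_gt0 Kp).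
exists ('X^(p ^ a i) - (frob_pow p w a i)%:P); split.
- by rewrite -size_poly_eq0 size_XnsubC.
- move=> j; rewrite coefB coefXn coefC; apply: adjoin_sub.
    by case: (j == _); [apply: adjoin1|apply: adjoin0].
  by case: (j == _); [apply: adjoin_gen|apply: adjoin0].
- by apply/rootP; rewrite hornerD hornerN hornerXn hornerC subrr.
Qed.

Record derivation (D : F -> F -> Prop) : Prop := Derivation {
  der_dual : dual_subring D;
  der_const : forall c, D (iota c) 0;
  der_fun0 : forall v, D 0 v -> v = 0
}.

Lemma der_fun D x v w : derivation D -> D x v -> D x w -> v = w.
Proof.
move=> HD Dv Dw; apply/subr0_eq/(der_fun0 HD).
by rewrite -[0](subrr x); apply: (dualB (der_dual HD)).
Qed.

(** The coefficients are the partial derivatives of the relation. They are chosen before D, so the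
    same linear relation holds for all three coordinate derivations. *)
Lemma reln_lin m (w : 'I_m -> F) a (I : pred 'I_m) : reln w a I -> exists c : 'I_m -> F,
  (forall i, I i -> c i != 0) /\ forall D d, derivation D ->
  (forall i, I i -> D (frob_pow p w a i) (d i)) -> \sum_(i | I i) c i * d i = 0.
Proof.
move=> [P [Pw oP dP]]; exists (fun i => ev (frob_pow p w a) P^`M(i)); split=> // D d HD Dw.
pose w' i := if I i then frob_pow p w a i else 0.
pose d' i := if I i then d i else 0.
have e Q : (forall i, occurs Q i -> occurs P i) -> ev w' Q = ev (frob_pow p w a) Q.
  by move=> QP; apply: ev_agree => i /QP/oP Ii; rewrite /w' Ii.
apply: (der_fun0 HD); rewrite -{1}Pw -e // big_mkcond /=.
rewrite (_ : \sum_i _ = \sum_i ev w' P^`M(i) * d' i).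
  apply: dual_mpoly; [exact: der_dual|exact: der_const|].
  move=> i; rewrite /w' /d'; case: ifP => [/Dw//|_]; exact: dual0 (der_dual HD).
apply: eq_bigr => i _; rewrite /d'; case: ifP => [_|_]; last by rewrite mulr0.
by rewrite e // => j; apply: occurs_mderiv.
Qed.

Definition separable_at (D : F -> F -> Prop) b : Prop := exists h k,
  [/\ dual_poly D h k, h.[b] = 0 & h^`().[b] != 0].

Lemma derivation_extend D b : derivation D -> separable_at D b ->
  exists D', [/\ derivation D', forall x v, D x v -> D' x v & exists v, D' b v].
Proof.
move=> HD [h [k [Dh hb dhb]]]; have Dd := der_dual HD.
(* The value forced by differentiating h(b) = 0. *)
pose w := - k.[b] / h^`().[b].
have w0 : k.[b] + h^`().[b] * w = 0 by rewrite /w mulrC divfK // subrr.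
exists (dual_ext D b w); split.
- split; first exact: dual_ext_subring.
    by move=> c; apply: dual_ext_sub => //; apply: der_const.
  exact: (dual_ext0 Dd (der_fun0 HD) Dh hb dhb w0).
- exact: dual_ext_sub.
- by exists w; apply: dual_ext_gen.
Qed.

Lemma derivation_extend_all D (bs : seq F) : derivation D ->
  (forall b, b \in bs -> separable_at D b) ->
  exists D', [/\ derivation D', forall x v, D x v -> D' x v
    & forall b, b \in bs -> exists v, D' b v].
Proof.
elim: bs D => [|b bs IH] D HD sep; first by exists D.
have [D1 [HD1 DD1 [v D1b]]] := derivation_extend HD (sep _ (mem_head _ _)).
have [|D2 [HD2 DD2 D2bs]] := IH _ HD1.
  move=> x xbs; have [|h [k [Dh hx dhx]]] := sep x; first by rewrite inE xbs orbT.
  by exists h, k; split=> // i; apply: DD1.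
exists D2; split=> // [x u /DD1/DD2//|x].
by rewrite inE => /orP[/eqP ->|/D2bs//]; exists v; apply: DD2.
Qed.

Lemma derivation_coordinate m (B : 'I_m -> F) (k : 'I_m) :
  (forall P, ev B P = 0 -> P = 0) ->
  exists D, derivation D /\ forall j, D (B j) (j == k)%:R.
Proof.
move=> indep; exists (fun x v => exists P, x = ev B P /\ v = ev B P^`M(k)).
split; last first.
  move=> j; exists 'X_j; rewrite /mp_eval mmapX mmap1U; split=> //.
  rewrite mderivX mnm1E; case: eqP => [->|_]; last by rewrite scale0r mmap0.
  by rewrite scale1r -{1}[U_(k)%MM]add0m addmK mpolyX0 [RHS](rmorph1 (ev B)).
split.
- split=> [|_ _ _ _ [P [-> ->]] [Q [-> ->]]|_ _ _ _ [P [-> ->]] [Q [-> ->]]].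
  + exists 1; split; first exact/esym/(rmorph1 (ev B)).
    rewrite -mpolyC1 mderivC; exact/esym/(rmorph0 (ev B)).
  + by exists (P - Q); rewrite mderivB !rmorphB.
  + by exists (P * Q); rewrite mderivM rmorphD !rmorphM /=; split=> //; ring.
- by move=> c; exists c%:MP; rewrite mderivC /mp_eval mmapC mmap0.
- by move=> v [P [/esym/indep -> ->]]; rewrite mderiv0 rmorph0.
Qed.

End Relations.

(** * Differentials of a twisted representation *)

Section Shadow.
Variables (K F : fieldType) (iota : {rmorphism K -> F}) (p : nat).
Hypothesis Kp : expchar K p.
Let Fp : expchar F p := expchar_rmorph iota Kp.
Local Notation ev := (mp_eval iota).
Local Notation cl := (alg_cl iota).
Variables (E : finType) (pi : E -> F) (b : 'I_3 -> E).

Definition with_base q : 'I_4 -> F :=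
  fun i => oapp (fun j => pi (b j)) (pi q) (unlift ord_max i).

Definition dependent (T : {ffun 'I_3 -> E}) : Prop :=
  exists2 P : {mpoly K[3]}, P != 0 & ev (fun i => pi (T i)) P = 0.

Hypothesis b_indep :
  forall j, ~ cl (fun x => exists2 i, i != j & x = pi (b i)) (pi (b j)).
Hypothesis b_span : forall q,
  exists2 P : {mpoly K[4]}, P != 0 & ev (with_base q) P = 0.
Hypothesis q_trans : forall q, ~ cl (fun=> False) (pi q).

Lemma with_base_lift q j : with_base q (lift ord_max j) = pi (b j).
Proof. by rewrite /with_base liftK. Qed.

Lemma with_base_max q : with_base q ord_max = pi q.
Proof. by rewrite /with_base unlift_none. Qed.

Lemma base_no_reln a I : reln iota p (fun j => pi (b j)) a I -> ~ exists i, I i.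
Proof.
move=> r [i Ii]; apply: (b_indep (j := i)).
by apply: cl_mono (reln_cl Kp r Ii) => x [j /andP[_ ji] ->]; exists j.
Qed.

Lemma base_independent e (P : {mpoly K[3]}) :
  ev (frob_pow p (fun j => pi (b j)) e) P = 0 -> P = 0.
Proof.
move=> Pb; apply/eqP; apply: contrapT => /negP P0.
have [a [I [[Q [Qb oQ dQ]] exI]]] := reln_exists Kp P0 Pb.
apply: (base_no_reln (a := fun j => (e j + a j)%N)) exI; exists Q.
have -> : frob_pow p (fun j => pi (b j)) (fun j => e j + a j)%N
  = frob_pow p (frob_pow p (fun j => pi (b j)) e) a.
  by apply/funext => j; rewrite /frob_pow expnD exprM.
by split.
Qed.

(** q occurs because the basis alone satisfies no relation; a basis element occurs because q is not
    algebraic over K. *)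
Lemma span_reln q : exists a I, [/\ reln iota p (with_base q) a I, I ord_max
  & exists j : 'I_3, I (lift ord_max j)].
Proof.
have [P P0 Pq] := b_span q.
have [a [I [r [i Ii]]]] := reln_exists Kp P0 Pq.
have Imax : I ord_max.
  apply/negP => nI; case: (unliftP ord_max i) Ii => [j ->|->] // Ij.
  apply: (b_indep (j := j)); have := reln_cl Kp r Ij; rewrite with_base_lift.
  apply: cl_mono => x [k /andP[Ik kj] ->].
  case: (unliftP ord_max k) Ik kj => [l ->|->] // Il lj.
  rewrite with_base_lift; exists l => //.
  by apply: contraNneq lj => ->.
exists a, I; split=> //; apply: contrapT => nI.
apply: (q_trans (q := q)); have := reln_cl Kp r Imax; rewrite with_base_max.
apply: cl_mono => x [k /andP[Ik kmax] _].
case: (unliftP ord_max k) Ik kmax => [l ->|->] Il; last by rewrite eqxx.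
by case: nI; exists l.
Qed.

Section AtLevel.
Variables (aq : E -> 'I_4 -> nat) (Iq : E -> pred 'I_4).
Hypothesis rq : forall q, reln iota p (with_base q) (aq q) (Iq q).
Hypothesis Imax : forall q, Iq q ord_max.
Hypothesis Ibase : forall q, exists j : 'I_3, Iq q (lift ord_max j).
Variables (eb : 'I_3 -> nat).
Hypothesis eb_ge : forall q j, (aq q (lift ord_max j) <= eb j)%N.

(** The least shift of the relation of q that lifts the exponent of every occurring basis element to
    at least [eb j], where derivations are prescribed. By [eb_ge] no subtraction truncates, so
    equality is attained somewhere, and there the basis element keeps a nonzero differential. *)
Definition shift_of q : nat :=
  \max_(j < 3 | Iq q (lift ord_max j)) (eb j - aq q (lift ord_max j)).

Lemma shift_ge q j : Iq q (lift ord_max j) ->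
  (eb j <= aq q (lift ord_max j) + shift_of q)%N.
Proof.
move=> Ij; rewrite -leq_subLR.
exact: (@leq_bigmax_cond _ (fun j => Iq q (lift ord_max j))
  (fun j => eb j - aq q (lift ord_max j))%N).
Qed.

Lemma shift_attained q : exists j, Iq q (lift ord_max j) /\
  (aq q (lift ord_max j) + shift_of q)%N = eb j.
Proof.
have [j0 Ij0] := Ibase q.
have [j Ij sj] : {j | Iq q (lift ord_max j)
    & shift_of q = (eb j - aq q (lift ord_max j))%N}.
  by apply: eq_bigmax_cond; apply/card_gt0P; exists j0.
by exists j; rewrite sj subnKC.
Qed.

Definition exp_of q : nat := (aq q ord_max + shift_of q)%N.

Lemma exp_derivation k : exists D, [/\ derivation iota D,
  forall j, D (pi (b j) ^+ (p ^ eb j)) (j == k)%:R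
  & forall q, exists v, D (pi q ^+ (p ^ exp_of q)) v].
Proof.
have [D [HD DB]] := derivation_coordinate k (@base_independent eb).
have [|D' [HD' DD' Dq]] :=
    derivation_extend_all (bs := [seq pi q ^+ (p ^ exp_of q) | q <- enum E]) HD.
  move=> _ /mapP[q _ ->].
  have r := reln_shift Kp (shift_of q) (rq q).
  have -> : pi q ^+ (p ^ exp_of q) =
      frob_pow p (with_base q) (fun i => aq q i + shift_of q)%N ord_max.
    by rewrite /frob_pow with_base_max.
  apply: (reln_sep (der_dual HD) (der_const HD) r (Imax q)) => i.
  case: (unliftP ord_max i) => [j ->|->] jm Ij; last by rewrite eqxx in jm.
  rewrite /frob_pow with_base_lift.
  have := dual_frobenius (der_dual HD) Fp (shift_ge Ij) (DB j).
  by move=> h; eexists; apply: h.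
exists D'; split=> // [j|q]; first by apply/DD'/DB.
by apply/Dq/map_f/mem_enum.
Qed.

(** Take k where the shift is attained. Differentiating the relation of q by D_k leaves a single
    basis term, with nonzero coefficient, so the term of q cannot vanish. *)
Lemma exp_nonzero q (d : 'I_3 -> F) (D : 'I_3 -> F -> F -> Prop) :
  (forall k, derivation iota (D k)) ->
  (forall k j, D k (pi (b j) ^+ (p ^ eb j)) (j == k)%:R) ->
  (forall k, D k (pi q ^+ (p ^ exp_of q)) (d k)) -> exists k, d k != 0.
Proof.
move=> HD Db Dq; have r := reln_shift Kp (shift_of q) (rq q).
have [c [c0 clin]] := reln_lin r; have [k [Ik ek]] := shift_attained q.
exists k; apply: contraTneq isT => dk0.
pose v (i : 'I_4) : F := oapp (fun j : 'I_3 =>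
  if (p == 1%N) || ((aq q (lift ord_max j) + shift_of q)%N == eb j)
  then (j == k)%:R else 0) 0 (unlift ord_max i).
have := clin _ v (HD k); rewrite (bigD1 (lift ord_max k)) //=.
rewrite big1 => [|i /andP[Ii ik]].
  rewrite /v liftK /= ek !eqxx orbT /= mulr1 addr0 => h.
  have /eqP := c0 _ Ik; rewrite h // => i Ii.
  case: (unliftP ord_max i) Ii => [j ->|->] Ij.
    rewrite /frob_pow with_base_lift /=.
    by have := dual_frobenius (der_dual (HD k)) Fp (shift_ge Ij) (Db k j).
  by rewrite /frob_pow with_base_max /= -dk0; apply: Dq.
case: (unliftP ord_max i) ik => [j ->|->] jk.
  rewrite /v liftK /=; have /negPf -> : j != k by apply: contraNneq jk => ->.
  by rewrite if_same mulr0.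
by rewrite /v unlift_none mulr0.
Qed.

End AtLevel.

Definition o0 : 'I_3 := @Ordinal 3 0 isT.
Definition o1 : 'I_3 := @Ordinal 3 1 isT.
Definition o2 : 'I_3 := @Ordinal 3 2 isT.

Lemma sum3 (f : 'I_3 -> F) : \sum_i f i = f o0 + (f o1 + f o2).
Proof.
rewrite !big_ord_recl big_ord0 addr0.
by congr (f _ + (f _ + f _)); apply: val_inj.
Qed.

Lemma ord3P (k : 'I_3) : [\/ k = o0, k = o1 | k = o2].
Proof.
by case: k => [[|[|[|k]]] lt_k] //; [constructor 1|constructor 2|constructor 3];
  apply: val_inj.
Qed.

(** The relation is shifted until its exponents reach the twist [e], with equality somewhere. For p
    > 1 the variables with equality, collected in [J], keep their differentials; the others have
    become p-th powers of twisted elements and drop out. Two occurring variables with equal gaps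
    between [e] and [a] are thus kept or dropped together. *)
Lemma relation_lin (e : E -> nat) (T : {ffun 'I_3 -> E}) a (I : pred 'I_3)
    (D : 'I_3 -> F -> F -> Prop) (d : E -> 'I_3 -> F) :
  reln iota p (fun i => pi (T i)) a I -> (exists i, I i) ->
  (forall i, a i <= e (T i))%N ->
  (forall k, derivation iota (D k)) ->
  (forall q k, D k (pi q ^+ (p ^ e q)) (d q k)) ->
  exists c : 'I_3 -> F, [/\ exists i, c i != 0,
    forall k, \sum_i c i * d (T i) k = 0
    & forall i j, I i -> I j -> (e (T i) + a j = e (T j) + a i)%N ->
      (c i == 0) = (c j == 0)].
Proof.
move=> r [i0 Ii0] age HD Dd.
pose n := (\max_(i | I i) (e (T i) - a i))%N.
have le_n i : I i -> (e (T i) <= a i + n)%N.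
  move=> Ii; rewrite -leq_subLR.
  exact: (@leq_bigmax_cond _ I (fun i => e (T i) - a i)%N).
have [m [Im em]] : exists m, I m /\ (a m + n)%N = e (T m).
  have [m Im sm] : {m | I m & n = (e (T m) - a m)%N}.
    by apply: eq_bigmax_cond; apply/card_gt0P; exists i0.
  by exists m; rewrite sm subnKC.
have [c [c0 clin]] := reln_lin (reln_shift Kp n r).
pose J i := I i && ((p == 1%N) || ((a i + n)%N == e (T i))).
exists (fun i => if J i then c i else 0); split.
- by exists m; rewrite /J Im em eqxx orbT; apply: c0.
- move=> k; rewrite -[RHS](clin (D k) (fun i => if J i then d (T i) k else 0) (HD k)).
    rewrite [RHS]big_mkcond; apply: eq_bigr => i _; rewrite /J.
    by case: (I i) => /=; rewrite ?mul0r //; case: (_ || _); rewrite ?mulr0 ?mul0r.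
  move=> i Ii; rewrite /J Ii /=.
  by have := dual_frobenius (der_dual (HD k)) Fp (le_n i Ii) (Dd (T i) k).
- move=> i j Ii Ij eij; have -> : J i = J j.
    by rewrite /J Ii Ij; congr (_ || _); apply/eqP/eqP; lia.
  by case: (J j); rewrite ?eqxx // (negPf (c0 _ Ii)) (negPf (c0 _ Ij)).
Qed.

Lemma b_inj : injective b.
Proof.
move=> i j bij; apply: contrapT => /eqP ij; apply: (b_indep (j := j)).
by apply: cl_mem; exists i; rewrite ?bij.
Qed.

Definition circuit (T : {ffun 'I_3 -> E}) : Prop := dependent T /\
  forall a I, reln iota p (fun i => pi (T i)) a I -> (exists i, I i) -> forall i, I i.

Theorem linear_shadow (Tu Tv : {ffun 'I_3 -> E}) :
  circuit Tu -> Tu o0 = b o0 -> Tu o1 = b o1 ->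
  circuit Tv -> Tv o0 = b o1 -> Tv o1 = b o2 ->
  exists d : E -> 'I_3 -> F,
  [/\ forall j k, d (b j) k = (j == k)%:R,
      forall q, exists k, d q k != 0,
      forall T, dependent T ->
        exists2 c : 'I_3 -> F, exists i, c i != 0
          & forall k, \sum_i c i * d (T i) k = 0,
      [/\ d (Tu o2) o0 != 0, d (Tu o2) o1 != 0 & d (Tu o2) o2 = 0]
    & [/\ d (Tv o2) o0 = 0, d (Tv o2) o1 != 0 & d (Tv o2) o2 != 0]].
Proof.
move=> cu u0 u1 cv v0 v1.
have [aq aqP] := choice span_reln; have [Iq IqP] := choice aqP.
have rq q : reln iota p (with_base q) (aq q) (Iq q) by case: (IqP q).
have Imax q : Iq q ord_max by case: (IqP q).
have Ibase q : exists j : 'I_3, Iq q (lift ord_max j) by case: (IqP q).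
have exT (T : {ffun 'I_3 -> E}) : exists aI : ('I_3 -> nat) * pred 'I_3, dependent T ->
    reln iota p (fun i => pi (T i)) aI.1 aI.2 /\ exists i, aI.2 i.
  case: (EM (dependent T)) => [dT|ndT]; last by exists (fun=> 0%N, xpred0) => /ndT.
  have [P P0 PT] := dT; have [a [I [r exI]]] := reln_exists Kp P0 PT.
  by exists (a, I).
have [aI aIP] := choice exT.
pose A : nat := (\sum_q \sum_j aq q j)%N.
pose B : nat := (\sum_T \sum_i (aI T).1 i)%N.
have leA q j : (aq q j <= A)%N.
  by rewrite /A (bigD1 q) //= (bigD1 j) //= -addnA leq_addr.
have leB T i : ((aI T).1 i <= B)%N.
  by rewrite /B (bigD1 T) //= (bigD1 i) //= -addnA leq_addr.
pose au := (aI Tu).1; pose av := (aI Tv).1.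
(* A solution in natural numbers of al0 - al1 = au0 - au1 and al1 - al2 = av0 - av1, so that on each
   line the two basis elements survive together. Adding [A + B] keeps the differences and lifts all
   twists above the exponents in the chosen relations. *)
pose al (j : 'I_3) : nat := nth 0%N
  [:: au o0 + av o0; au o1 + av o0; av o1 + au o1]%N j.
pose eb j := (al j + (A + B))%N.
have eb_ge q j : (aq q (lift ord_max j) <= eb j)%N.
  by have := leA q (lift ord_max j); rewrite /eb; lia.
pose ex := exp_of aq Iq eb.
have ex_ge q : (B <= ex q)%N.
  have [j [_ ej]] := shift_attained Ibase eb_ge q.
  have := leA q (lift ord_max j); move: ej; rewrite /ex /exp_of /eb; lia.
have [D DP] := choice (exp_derivation rq Imax eb).
(* [exp_of] may assign a basis element another exponent; [eb] makes its differential a unit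
   vector. *)
pose e q := if [pick j | b j == q] is Some j then eb j else ex q.
have eE j : e (b j) = eb j.
  rewrite /e; case: pickP => [i /eqP/b_inj -> //|/(_ j)]; by rewrite eqxx.
have e_ge q : (B <= e q)%N.
  by rewrite /e; case: pickP => // j _; rewrite /eb; lia.
have HD k : derivation iota (D k) by case: (DP k).
have Db k j : D k (pi (b j) ^+ (p ^ eb j)) (j == k)%:R by case: (DP k).
have exd (qk : E * 'I_3) : exists v, D qk.2 (pi qk.1 ^+ (p ^ e qk.1)) v.
  case: qk => q k /=; rewrite /e; case: pickP => [j /eqP <-|_]; last by case: (DP k).
  by exists (j == k)%:R; apply: Db.
have [d0 d0P] := choice exd; pose d q k := d0 (q, k).
have dP q k : D k (pi q ^+ (p ^ e q)) (d q k) by apply: (d0P (q, k)).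
have db j k : d (b j) k = (j == k)%:R.
  by apply: (der_fun (HD k) (dP _ _)); rewrite eE.
have dnz q : exists k, d q k != 0.
  case: (EM (exists j, b j = q)) => [[j <-]|nq].
    by exists j; rewrite db eqxx oner_eq0.
  have eq : e q = ex q.
    by rewrite /e; case: pickP => // j /eqP bj; case: nq; exists j.
  apply: (exp_nonzero rq Ibase eb_ge (q := q) HD Db) => k.
  by have := dP q k; rewrite eq.
have lin T : dependent T -> exists c : 'I_3 -> F, [/\ exists i, c i != 0,
    forall k, \sum_i c i * d (T i) k = 0
    & forall i j, (aI T).2 i -> (aI T).2 j ->
      (e (T i) + (aI T).1 j = e (T j) + (aI T).1 i)%N -> (c i == 0) = (c j == 0)].
  move=> /aIP[r exI]; apply: (relation_lin r exI) (dP) => // i.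
  exact: leq_trans (leB T i) (e_ge _).
(* [c o2] is nonzero since the basis differentials are independent. [c o0] and [c o1] vanish
   together by the choice of [al]; if they did, the differential of the third point would be
   zero. *)
have third (T : {ffun 'I_3 -> E}) i j : circuit T -> T o0 = b i -> T o1 = b j ->
    i != j -> (al i + (aI T).1 o1 = al j + (aI T).1 o0)%N ->
    [/\ d (T o2) i != 0, d (T o2) j != 0
      & forall k, k != i -> k != j -> d (T o2) k = 0].
  move=> [dT IT] T0 T1 ij alij; have [r exI] := aIP _ dT.
  have allI := IT _ _ r exI; have [c [[m cm] clin ceq]] := lin _ dT.
  have c01 : (c o0 == 0) = (c o1 == 0).
    by apply: ceq => //; rewrite T0 T1 !eE /eb; lia.
  have eqk k : c o0 * (i == k)%:R + (c o1 * (j == k)%:R + c o2 * d (T o2) k) = 0.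
    by rewrite -[RHS](clin k) sum3 T0 T1 !db.
  have eqi : c o0 + c o2 * d (T o2) i = 0.
    by have := eqk i; rewrite eqxx [j == i]eq_sym (negPf ij) mulr1 mulr0 add0r.
  have eqj : c o1 + c o2 * d (T o2) j = 0.
    by have := eqk j; rewrite eqxx (negPf ij) mulr1 mulr0 add0r.
  have c2 : c o2 != 0.
    apply/eqP => c2; move: eqi eqj cm; rewrite c2 !mul0r !addr0 => c0 c1.
    by case: (ord3P m) => ->; rewrite ?c0 ?c1 ?c2 eqxx.
  have c0 : c o0 != 0.
    apply/negP => c0; have [k /eqP] := dnz (T o2); apply; apply/eqP.
    have := eqk k; rewrite (eqP c0); move: c0; rewrite c01 => /eqP ->.
    by rewrite !mul0r !add0r => /eqP; rewrite mulf_eq0 (negPf c2).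
  have c1 : c o1 != 0 by rewrite -c01.
  split.
  - by apply: contraNneq c0 => dz; rewrite -eqi dz mulr0 addr0.
  - by apply: contraNneq c1 => dz; rewrite -eqj dz mulr0 addr0.
  - move=> k ki kj; have := eqk k; rewrite ![_ == k]eq_sym (negPf ki) (negPf kj).
    by rewrite !mulr0 !add0r => /eqP; rewrite mulf_eq0 (negPf c2) => /eqP.
have [||du0 du1 du2] := third _ o0 o1 cu u0 u1 => //.
  by rewrite /al /= /au /av; lia.
have [||dv1 dv2 dv0] := third _ o1 o2 cv v0 v1 => //.
  by rewrite /al /= /au /av; lia.
exists d; split=> // [T /lin[c [exc cl _]]||].
- by exists c.
- by split=> //; apply: du2.
- by split=> //; apply: dv0.
Qed.

End Shadow.

(** * Differentials of an algebraic rank 3 matroid *)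

Section AlgebraicShadow.
Variables (K F : fieldType) (iota : {rmorphism K -> F}).
Local Notation cl := (alg_cl iota).
Variables (E : finType) (rk : {set E} -> nat) (pi : E -> F).
Hypothesis rep : forall X : {set E},
  trdeg_is iota (adjoin iota (fun x => exists2 e, e \in X & x = pi e)) (rk X).

Lemma full_rank_not_cl m (T : 'I_m -> E) j : rk [set T i | i : 'I_m] = m ->
  ~ cl (fun x => exists2 i, i != j & x = pi (T i)) (pi (T j)).
Proof.
move=> rkT clj; have := rep [set T i | i : 'I_m]; rewrite rkT => h.
pose l := [seq pi (T i) | i <- enum (predC1 j)].
have szl : size l = m.-1 by rewrite size_map -cardE cardC1 card_ord.
have := trdeg_le (l := l) h; rewrite szl => le.
have : (m <= m.-1)%N.
  apply: le => x [_ /imsetP[i _ ->] ->].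
  have lP k : k != j -> mem_of l (pi (T k)).
    by move=> kj; apply: map_f; rewrite mem_enum.
  have [->|ij] := eqVneq i j; last exact/cl_mem/lP.
  by apply: cl_mono clj => _ [k /lP lk ->].
by have := ltn_ord j; lia.
Qed.

Lemma low_rank_relation m (T : 'I_m -> E) : (rk [set T i | i : 'I_m] < m)%N ->
  exists2 P : {mpoly K[m]}, P != 0 & mp_eval iota (fun i => pi (T i)) P = 0.
Proof.
move=> rkT; pose l := [seq pi (T i) | i <- enum 'I_m].
have szl : size l = m by rewrite size_map size_enum_ord.
have [||i lti] := trdeg_ge (rep [set T i | i : 'I_m]) (l := l).
- move=> x /mapP[i _ ->]; exists (T i) => //; exact: imset_f.
- by rewrite szl.
rewrite szl in lti; set t := Ordinal lti.
have lE k (ltk : (k < m)%N) : l`_k = pi (T (Ordinal ltk)).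
  rewrite (nth_map t) ?size_enum_ord //; congr (pi (T _)).
  by apply: val_inj; rewrite /= nth_enum_ord.
rewrite (lE _ lti) => clt; apply: (@cl_mpoly _ _ _ _ _ t).
apply: cl_mono clt => x /(nthP 0)[k]; rewrite size_take szl lti => ltk <-.
have ltkm := ltn_trans ltk lti.
exists (Ordinal ltkm); first by rewrite -val_eqE /= ltn_eqF.
by rewrite nth_take // lE.
Qed.

Lemma nonloop_not_cl q : (0 < rk [set q])%N -> ~ cl (fun=> False) (pi q).
Proof.
move=> rq clq; move: rq; rewrite ltnNge => /negP; apply.
apply: (trdeg_le (l := [::]) (rep [set q])) => x [e /set1P -> ->].
by apply: cl_mono clq.
Qed.

Definition triple (x y z : E) : {ffun 'I_3 -> E} := [ffun i : 'I_3 => nth x [:: x; y; z] i].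

Lemma triple_set x y z : [set triple x y z i | i : 'I_3] = [set x; y; z].
Proof.
apply/setP => e; rewrite !inE; apply/imsetP/idP => [[i _ ->]|].
  by rewrite ffunE; case: (ord3P i) => -> /=; rewrite eqxx ?orbT.
by move=> /orP[/orP[]|] /eqP ->; [exists o0|exists o1|exists o2]; rewrite ?ffunE.
Qed.

Lemma pair_not_cl x y z : rk [set x; y; z] = 3 -> ~ cl (fun s => s = pi y) (pi x).
Proof.
move=> r; have := @full_rank_not_cl _ (triple x y z) o0; rewrite triple_set ffunE.
move=> /(_ r) h hc; apply: h; apply: cl_mono hc => s ->.
by exists o1; rewrite ?ffunE.
Qed.

(** The rank 3 sets make the elements pairwise independent. A relation omitting one of them would
    make another algebraic over the remaining one. *)
Lemma triple_circuit p (Kp : expchar K p) x y u :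
  (rk [set x; y; u] < 3)%N ->
  (exists z, rk [set x; y; z] = 3) -> (exists z, rk [set x; u; z] = 3) ->
  (exists z, rk [set y; u; z] = 3) ->
  circuit iota p pi (triple x y u).
Proof.
move=> low [z1 r1] [z2 r2] [z3 r3]; split.
  by apply: low_rank_relation; rewrite triple_set.
have pair i j : i != j -> ~ cl (fun s => s = pi (triple x y u j)) (pi (triple x y u i)).
  have swap a b c : rk [set a; b; c] = 3 -> rk [set b; a; c] = 3.
    by rewrite [[set a; b]]setUC.
  case: (ord3P i) => ->; case: (ord3P j) => -> //= _; rewrite !ffunE /=;
  by apply: pair_not_cl; first [eassumption | apply: swap; eassumption].
move=> a I r [i0 Ii0] i; apply/negP => /negP nIi.
have ii0 : i != i0 by apply: contraNneq nIi => ->.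
have [j [ji0 jP]] : exists j, i0 != j /\ forall k, k != i0 -> k != i -> k = j.
  case: (ord3P i) ii0 {nIi} => ->; case: (ord3P i0) => -> // _;
  first [ by exists o0; split=> // k; case: (ord3P k) => ->
        | by exists o1; split=> // k; case: (ord3P k) => ->
        | by exists o2; split=> // k; case: (ord3P k) => -> ].
apply: (pair _ _ ji0); apply: cl_mono (reln_cl Kp r Ii0) => s [k /andP[Ik ki0] ->].
by congr (pi (triple _ _ _ _)); apply: jP => //; apply: contraNneq nIi => <-.
Qed.

Definition det3 (d : E -> 'I_3 -> F) (a b c : E) : F :=
  d a o0 * (d b o1 * d c o2 - d b o2 * d c o1)
  - d a o1 * (d b o0 * d c o2 - d b o2 * d c o0)
  + d a o2 * (d b o0 * d c o1 - d b o1 * d c o0).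

Theorem algebraic_shadow (b0 b1 b2 u v : E) :
  (forall X, rk X <= 3)%N -> (forall q, 0 < rk [set q])%N ->
  rk [set b0; b1; b2] = 3 ->
  (rk [set b0; b1; u] < 3)%N -> (rk [set b1; b2; v] < 3)%N ->
  rk [set b0; u; b2] = 3 -> rk [set b1; u; b2] = 3 ->
  rk [set b1; v; b0] = 3 -> rk [set b2; v; b0] = 3 ->
  exists d : E -> 'I_3 -> F,
  [/\ forall j k, d (triple b0 b1 b2 j) k = (j == k)%:R,
      forall q, exists k, d q k != 0,
      forall a b c, (rk [set a; b; c] < 3)%N -> det3 d a b c = 0,
      [/\ d u o0 != 0, d u o1 != 0 & d u o2 = 0]
    & [/\ d v o0 = 0, d v o1 != 0 & d v o2 != 0]].
Proof.
move=> rk3 rk1 rb ru rv r1 r2 r3 r4.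
have [p Kp] := expchar_exists K.
have cu : circuit iota p pi (triple b0 b1 u).
  by apply: triple_circuit => //; [exists b2|exists b2|exists b2].
have cv : circuit iota p pi (triple b1 b2 v).
  apply: triple_circuit => //; [exists b0|exists b0|exists b0] => //.
  by rewrite -rb setUC setUA.
have bi j : ~ cl (fun x => exists2 i, i != j & x = pi (triple b0 b1 b2 i))
    (pi (triple b0 b1 b2 j)).
  by apply: full_rank_not_cl; rewrite triple_set.
have bs q : exists2 P : {mpoly K[4]}, P != 0
    & mp_eval iota (with_base pi (triple b0 b1 b2) q) P = 0.
  pose T := fun i => oapp (triple b0 b1 b2) q (unlift ord_max i).
  have [|P P0 PT] := @low_rank_relation 4 T; first by rewrite ltnS rk3.
  exists P => //; rewrite -[RHS]PT; congr (mp_eval _ _ _); apply/funext => i.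
  by rewrite /with_base /T; case: (unlift _ _).
have qt q : ~ cl (fun=> False) (pi q) by apply: nonloop_not_cl.
have [| | | |d [db dnz ddep du dv]] := @linear_shadow _ _ iota p Kp _ pi
  (triple b0 b1 b2) bi bs qt (triple b0 b1 u) (triple b1 b2 v) cu _ _ cv;
  try by rewrite !ffunE.
exists d; split=> // [a b c rabc||].
- have [|k [i ci] clin] := ddep (triple a b c).
    by apply: low_rank_relation; rewrite triple_set.
  have e j : k o0 * d a j + (k o1 * d b j + k o2 * d c j) = 0.
    by rewrite -[RHS](clin j) sum3 !ffunE.
  have [e0 e1 e2] := And3 (e o0) (e o1) (e o2).
  (* Multiplying by a nonzero coefficient turns one row into a combination of the other two. *)
  suff : k i * det3 d a b c = 0 by move/eqP; rewrite mulf_eq0 (negPf ci) => /eqP.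
  rewrite /det3; case: (ord3P i) => ->.
  + have f j : k o0 * d a j = - (k o1 * d b j + k o2 * d c j).
      by apply/eqP; rewrite -addr_eq0 e.
    rewrite mulrDr mulrBr !mulrA !f; ring.
  + have f j : k o1 * d b j = - (k o0 * d a j + k o2 * d c j).
      by apply/eqP; rewrite -addr_eq0 -(e j); apply/eqP; ring.
    transitivity (d a o0 * ((k o1 * d b o1) * d c o2 - (k o1 * d b o2) * d c o1)
    - d a o1 * ((k o1 * d b o0) * d c o2 - (k o1 * d b o2) * d c o0)
    + d a o2 * ((k o1 * d b o0) * d c o1 - (k o1 * d b o1) * d c o0)); first by ring.
    rewrite !f; ring.
  + have f j : k o2 * d c j = - (k o0 * d a j + k o1 * d b j).
      by apply/eqP; rewrite -addr_eq0 -(e j); apply/eqP; ring.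
    transitivity (d a o0 * (d b o1 * (k o2 * d c o2) - d b o2 * (k o2 * d c o1))
    - d a o1 * (d b o0 * (k o2 * d c o2) - d b o2 * (k o2 * d c o0))
    + d a o2 * (d b o0 * (k o2 * d c o1) - d b o1 * (k o2 * d c o0))); first by ring.
    rewrite !f; ring.
- by move: du; rewrite !ffunE.
- by move: dv; rewrite !ffunE.
Qed.

End AlgebraicShadow.

(** * The matroid of the quaternion group *)

Section Stack.
Variables (F : fieldType) (k : nat).
Implicit Types A B C : 'M[F]_k.

Lemma stack3D A B C A' B' C' :
  stack3 A B C + stack3 A' B' C' = stack3 (A + A') (B + B') (C + C').
Proof. by rewrite /stack3 !add_col_mx. Qed.

Lemma stack3M A B C M : stack3 A B C *m M = stack3 (A *m M) (B *m M) (C *m M).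
Proof. by rewrite /stack3 !mul_col_mx. Qed.

Lemma stack3_lin (x y z : F) A B C A' B' C' A'' B'' C'' X Y Z :
  X = x *: A + y *: A' + z *: A'' -> Y = x *: B + y *: B' + z *: B'' ->
  Z = x *: C + y *: C' + z *: C'' ->
  stack3 X Y Z = stack3 A B C *m x%:M + stack3 A' B' C' *m y%:M
    + stack3 A'' B'' C'' *m z%:M.
Proof. by move=> -> -> ->; rewrite !stack3M !stack3D !mul_mx_scalar. Qed.

Lemma stack3_eq0 A B C : stack3 A B C = 0 -> [/\ A = 0, B = 0 & C = 0].
Proof.
rewrite /stack3 => e; have := congr1 usubmx e; have := congr1 dsubmx e.
rewrite col_mxKd col_mxKu !raddf0 => e' ->.
have := congr1 usubmx e'; have := congr1 dsubmx e'.
by rewrite col_mxKd col_mxKu !raddf0 => -> ->.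
Qed.

Lemma stack3_full m (W : 'M[F]_(m, k + (k + k))) :
  ((stack3 1%:M 0 0)^T <= W)%MS -> ((stack3 0 1%:M 0)^T <= W)%MS ->
  ((stack3 0 0 1%:M)^T <= W)%MS -> \rank W = (k + (k + k))%N.
Proof.
rewrite /stack3 !tr_col_mx !trmx0 !trmx1 => W1 W2 W3.
apply/eqP; rewrite -/(row_full W) -sub1mx.
apply/row_subP => i; move: (row i _) => w.
rewrite -[w]hsubmxK -[rsubmx w]hsubmxK; set x := lsubmx w.
set y := lsubmx _; set z := rsubmx _.
have -> : row_mx x (row_mx y z) = x *m row_mx 1%:M (row_mx 0 0)
    + (y *m row_mx 0 (row_mx 1%:M 0) + z *m row_mx 0 (row_mx 0 1%:M)).
  by rewrite !mul_mx_row !mulmx1 !mulmx0 !add_row_mx !(addr0, add0r).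
by rewrite !addmx_sub // mulmx_sub.
Qed.

End Stack.

Section BlockRank3.
Variables (E : finType) (F : fieldType) (n k : nat) (A : E -> 'M[F]_(n, k)).

Lemma block_rank3 a b c :
  block_rank A [set a; b; c] = \rank ((A a)^T + (A b)^T + (A c)^T)%MS.
Proof.
rewrite /block_rank; apply: eqmx_rank; apply/andP; split.
  apply/sumsmx_subP => e; rewrite !inE genmxE => /orP[/orP[]|] /eqP ->.
  - by rewrite -addsmxA addsmxSl.
  - by apply: submx_trans (addsmxSr _ _) (addsmxSl _ _).
  - exact: addsmxSr.
rewrite !addsmx_sub -!andbA; apply/and3P; split.
- by rewrite -(genmxE (A a)^T); apply: (sumsmx_sup a) => //; rewrite !inE eqxx.
- by rewrite -(genmxE (A b)^T); apply: (sumsmx_sup b) => //; rewrite !inE eqxx orbT.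
- by rewrite -(genmxE (A c)^T); apply: (sumsmx_sup c) => //; rewrite !inE eqxx orbT.
Qed.

Lemma block_rank3_low a b c M N : A c = A a *m M + A b *m N ->
  (block_rank A [set a; b; c] <= k + k)%N.
Proof.
move=> Ac; rewrite block_rank3.
have -> : \rank ((A a)^T + (A b)^T + (A c)^T)%MS = \rank ((A a)^T + (A b)^T)%MS.
  apply/eqP; rewrite eqn_leq !mxrankS ?addsmxSl // addsmx_sub submx_refl /=.
  rewrite Ac raddfD /= !trmx_mul addmx_sub //; apply: mulmx_sub.
    exact: addsmxSl.
  exact: addsmxSr.
by apply: leq_trans (mxrank_adds_leqif _ _) (leq_add _ _); apply: rank_leq_row.
Qed.

Lemma block_rank1 a : block_rank A [set a] = \rank (A a).
Proof. by rewrite /block_rank big_set1 mxrank_gen mxrank_tr. Qed.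

Lemma comb_sub3 (B : 'M[F]_(n, k)) a b c M N P :
  B = A a *m M + A b *m N + A c *m P ->
  (B^T <= (A a)^T + (A b)^T + (A c)^T)%MS.
Proof.
move=> ->; rewrite !raddfD /= !trmx_mul !addmx_sub //; apply: mulmx_sub.
- by rewrite -addsmxA addsmxSl.
- by apply: submx_trans (addsmxSr _ _) (addsmxSl _ _).
- exact: addsmxSr.
Qed.

End BlockRank3.

Section QnfRank.
Variables (F49 : finFieldType) (card49 : #|F49| = 49%N).
Variables (zeta : F49) (zeta_prim : 4.-primitive_root zeta).
Local Notation M := (qnf card49 zeta_prim).
Local Notation rho := (q8_rho zeta).

Lemma qnf_rkE X : (2 * rk M X)%N = block_rank (qnf_block zeta) X.
Proof. exact: (block_matroid_rkK (qnf_dvd card49 zeta_prim)). Qed.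

Lemma qnf_rk_le3 X : (rk M X <= 3)%N.
Proof. by rewrite -(leq_pmul2l (ltn0Sn 1)) qnf_rkE rank_leq_col. Qed.

Lemma qnf_rk_gt0 e : (0 < rk M [set e])%N.
Proof.
rewrite lt0n; apply/eqP => r0; have := qnf_rkE [set e].
rewrite r0 block_rank1 muln0 => /esym/eqP; rewrite mxrank_eq0 => /eqP e0.
have nz : (1%:M : 'M[F49]_2) <> 0.
  by move/matrixP/(_ 0 0)/eqP; rewrite !mxE oner_eq0.
have nz' : (- 1%:M : 'M[F49]_2) <> 0 by move/eqP; rewrite oppr_eq0 => /eqP.
by case: e {r0} e0 => [|||g|g|g|] /stack3_eq0[].
Qed.

Lemma qnf_low a b c P N :
  qnf_block zeta c = qnf_block zeta a *m P + qnf_block zeta b *m N ->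
  (rk M [set a; b; c] < 3)%N.
Proof.
by move=> /block_rank3_low; rewrite -qnf_rkE (leq_pmul2l (m := 2) (n2 := 2)) ltnS.
Qed.

Lemma qnf_full a b c :
  (forall e, e \in [:: P1; P2; P3] -> exists P N Q, qnf_block zeta e =
    qnf_block zeta a *m P + qnf_block zeta b *m N + qnf_block zeta c *m Q) ->
  rk M [set a; b; c] = 3.
Proof.
move=> h; apply/eqP; rewrite -(eqn_pmul2l (ltn0Sn 1)) qnf_rkE block_rank3.
apply/eqP; apply: stack3_full.
- have [|P [N [Q e]]] := h P1; [by rewrite !inE eqxx ?orbT | exact: comb_sub3 e].
- have [|P [N [Q e]]] := h P2; [by rewrite !inE eqxx ?orbT | exact: comb_sub3 e].
- have [|P [N [Q e]]] := h P3; [by rewrite !inE eqxx ?orbT | exact: comb_sub3 e].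
Qed.

Lemma qnf_lowG1 g : (rk M [set P1; P2; G1 g] < 3)%N.
Proof.
apply: (@qnf_low _ _ _ (- 1%:M) (rho g)); rewrite /= !stack3M stack3D.
by rewrite !(mul1mx, mul0mx, addr0, add0r).
Qed.

Lemma qnf_lowG2 g : (rk M [set P2; P3; G2 g] < 3)%N.
Proof.
apply: (@qnf_low _ _ _ (- 1%:M) (rho g)); rewrite /= !stack3M stack3D.
by rewrite !(mul1mx, mul0mx, addr0, add0r).
Qed.

Lemma qnf_lowG3 g : (rk M [set P1; P3; G3 g] < 3)%N.
Proof.
apply: (@qnf_low _ _ _ (rho g) (- 1%:M)); rewrite /= !stack3M stack3D.
by rewrite !(mul1mx, mul0mx, addr0, add0r).
Qed.

(** The chosen combination cancels the middle blocks, and the hypothesis turns the last block into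
    -I. *)
Lemma qnf_lowG g h k : rho h *m rho g *m rho k = 1%:M ->
  (rk M [set G1 g; G2 h; G3 k] < 3)%N.
Proof.
move=> e; apply: (@qnf_low _ _ _ (- rho k) (- (rho g *m rho k))).
rewrite /= !stack3M stack3D !(mulNmx, mulmxN, mul1mx, mul0mx, opprK).
by rewrite mulmxA e oppr0 addr0 addNr add0r.
Qed.

Definition q8e : q8 := (false, Qe).
Definition q8m : q8 := (true, Qe).

Lemma rho_e : rho q8e = 1%:M.
Proof. by rewrite -qmx_of; apply: qmx1. Qed.

Lemma rho_m : rho q8m = - 1%:M.
Proof. by rewrite -qmx_of; apply: qmxm1. Qed.

(** The blocks -I of the matrix bring in -e: the block of (-e)^(1) is the negative of (I, I, 0), so
    O lies on its line with p_3. *)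
Lemma qnf_lowO1 : (rk M [set P3; G1 q8m; PO] < 3)%N.
Proof.
apply: (@qnf_low _ _ _ 1%:M (- 1%:M)); rewrite /= rho_m !stack3M stack3D.
by rewrite !(mulmxN, mulmx1, opprK, oppr0, addr0, add0r).
Qed.

Lemma qnf_lowO2 : (rk M [set P1; G2 q8m; PO] < 3)%N.
Proof.
apply: (@qnf_low _ _ _ 1%:M (- 1%:M)); rewrite /= rho_m !stack3M stack3D.
by rewrite !(mulmxN, mulmx1, opprK, oppr0, addr0, add0r).
Qed.

Lemma qnf_lowO3 : (rk M [set P2; G3 q8m; PO] < 3)%N.
Proof.
apply: (@qnf_low _ _ _ 1%:M (- 1%:M)); rewrite /= rho_m !stack3M stack3D.
by rewrite !(mulmxN, mulmx1, opprK, oppr0, addr0, add0r).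
Qed.

Lemma qnf_full_scalar a b c :
  (forall e, e \in [:: P1; P2; P3] -> exists x y z : F49, qnf_block zeta e =
    qnf_block zeta a *m x%:M + qnf_block zeta b *m y%:M + qnf_block zeta c *m z%:M) ->
  rk M [set a; b; c] = 3.
Proof.
by move=> h; apply: qnf_full => e /h[x [y [z ->]]]; exists x%:M, y%:M, z%:M.
Qed.

(** The ranks required by [algebraic_shadow], with e^(1) and e^(2) as the generic points of the two
    prescribed lines. *)
Lemma qnf_basis : [/\ rk M [set P1; P2; P3] = 3, rk M [set P1; G1 q8e; P3] = 3,
  rk M [set P2; G1 q8e; P3] = 3, rk M [set P2; G2 q8e; P1] = 3
  & rk M [set P3; G2 q8e; P1] = 3].
Proof.
split; apply: qnf_full_scalar => e; rewrite !inE => /or3P[] /eqP ->;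
  rewrite /= ?rho_e.
- exists 1, 0, 0; by apply: stack3_lin; rewrite ?(scaler0, scale1r, scale0r, scaleN1r, addr0, add0r, opprK, oppr0, subrr, addNr).
- exists 0, 1, 0; by apply: stack3_lin; rewrite ?(scaler0, scale1r, scale0r, scaleN1r, addr0, add0r, opprK, oppr0, subrr, addNr).
- exists 0, 0, 1; by apply: stack3_lin; rewrite ?(scaler0, scale1r, scale0r, scaleN1r, addr0, add0r, opprK, oppr0, subrr, addNr).
- exists 1, 0, 0; by apply: stack3_lin; rewrite ?(scaler0, scale1r, scale0r, scaleN1r, addr0, add0r, opprK, oppr0, subrr, addNr).
- exists 1, 1, 0; by apply: stack3_lin; rewrite ?(scaler0, scale1r, scale0r, scaleN1r, addr0, add0r, opprK, oppr0, subrr, addNr).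
- exists 0, 0, 1; by apply: stack3_lin; rewrite ?(scaler0, scale1r, scale0r, scaleN1r, addr0, add0r, opprK, oppr0, subrr, addNr).
- exists 1, (-1), 0; by apply: stack3_lin; rewrite ?(scaler0, scale1r, scale0r, scaleN1r, addr0, add0r, opprK, oppr0, subrr, addNr).
- exists 1, 0, 0; by apply: stack3_lin; rewrite ?(scaler0, scale1r, scale0r, scaleN1r, addr0, add0r, opprK, oppr0, subrr, addNr).
- exists 0, 0, 1; by apply: stack3_lin; rewrite ?(scaler0, scale1r, scale0r, scaleN1r, addr0, add0r, opprK, oppr0, subrr, addNr).
- exists 0, 0, 1; by apply: stack3_lin; rewrite ?(scaler0, scale1r, scale0r, scaleN1r, addr0, add0r, opprK, oppr0, subrr, addNr).
- exists 1, 0, 0; by apply: stack3_lin; rewrite ?(scaler0, scale1r, scale0r, scaleN1r, addr0, add0r, opprK, oppr0, subrr, addNr).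
- exists 1, 1, 0; by apply: stack3_lin; rewrite ?(scaler0, scale1r, scale0r, scaleN1r, addr0, add0r, opprK, oppr0, subrr, addNr).
- exists 0, 0, 1; by apply: stack3_lin; rewrite ?(scaler0, scale1r, scale0r, scaleN1r, addr0, add0r, opprK, oppr0, subrr, addNr).
- exists 1, (-1), 0; by apply: stack3_lin; rewrite ?(scaler0, scale1r, scale0r, scaleN1r, addr0, add0r, opprK, oppr0, subrr, addNr).
- exists 1, 0, 0; by apply: stack3_lin; rewrite ?(scaler0, scale1r, scale0r, scaleN1r, addr0, add0r, opprK, oppr0, subrr, addNr).
Qed.

End QnfRank.

(** * Multiplication in the quaternion group *)

Definition q8_unit_mul (u v : q8_unit) : q8 :=
  match u, v with
  | Qe, w | w, Qe => (false, w)
  | Qi, Qi | Qj, Qj | Qk, Qk => (true, Qe)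
  | Qi, Qj => (false, Qk) | Qj, Qi => (true, Qk)
  | Qj, Qk => (false, Qi) | Qk, Qj => (true, Qi)
  | Qk, Qi => (false, Qj) | Qi, Qk => (true, Qj)
  end.

Definition q8_mul (g h : q8) : q8 :=
  let: (s, w) := q8_unit_mul g.2 h.2 in (g.1 (+) h.1 (+) s, w).

Definition q8_inv (g : q8) : q8 :=
  (if g.2 is Qe then g.1 else ~~ g.1, g.2).

Lemma qof_mul g h : qof (q8_mul g h) = qmul (qof g) (qof h).
Proof. by case: g => [[] []]; case: h => [[] []]; vm_compute. Qed.

Lemma qof_inv g : qmul (qof g) (qof (q8_inv g)) = q1.
Proof. by case: g => [[] []]; vm_compute. Qed.

Lemma q8_mule g : q8_mul g q8e = g. Proof. by case: g => [[] []]. Qed.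
Lemma q8_emul g : q8_mul q8e g = g. Proof. by case: g => [[] []]. Qed.
Lemma q8_pow4 g : q8_mul (q8_mul g g) (q8_mul g g) = q8e.
Proof. by case: g => [[] []]. Qed.

Lemma rho_inv (F : fieldType) (zeta : F) g h : zeta ^+ 2 = -1 ->
  q8_rho zeta h *m q8_rho zeta g *m q8_rho zeta (q8_inv (q8_mul h g)) = 1%:M.
Proof.
by move=> z2; rewrite -!qmx_of -!qmxM // -qof_mul qof_inv; apply: qmx1.
Qed.

(** * Coordinates of a weak image over a field *)

Section QnfField.
Variable F : fieldType.
(* Rows (a0 g, a1 g, 0), (0, b1 g, b2 g) and (c0 g, 0, c2 g) stand for g^(1),
   g^(2) and (g^-1)^(3), and (x, y, z) for O. *)
Variables (a0 a1 b1 b2 c0 c2 : q8 -> F) (x y z : F).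
Hypothesis a_nz : forall g, ~ (a0 g = 0 /\ a1 g = 0).
Hypothesis b_nz : forall g, ~ (b1 g = 0 /\ b2 g = 0).
Hypothesis c_nz : forall g, ~ (c0 g = 0 /\ c2 g = 0).
Hypotheses (a0e : a0 q8e != 0) (a1e : a1 q8e != 0).
Hypotheses (b1e : b1 q8e != 0) (b2e : b2 q8e != 0).
Hypothesis abc : forall g h,
  a0 g * b1 h * c2 (q8_mul h g) + a1 g * b2 h * c0 (q8_mul h g) = 0.

(** Nonvanishing is given only at e. With g or h equal to e, [abc] shows that a0, b1, c0 vanish at
    the same elements, and likewise a1, b2, c2. Then [abc h h] carries a zero at h to h^2, and since
    h^4 = e in Q_8, any zero would produce one at e. *)
Lemma qnf_field_nz g : [/\ a0 g != 0, a1 g != 0, b1 g != 0, b2 g != 0 & c0 g != 0].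
Proof.
have ag h := abc h q8e; have bg h := abc q8e h.
have a0c h : a0 h = 0 -> c0 h = 0.
  move=> a0h; have := ag h; rewrite q8_emul a0h !mul0r add0r => /eqP.
  rewrite !mulf_eq0 (negPf b2e) orbF => /orP[/eqP a1h|/eqP //].
  by case: (@a_nz h).
have c0b h : c0 h = 0 -> b1 h = 0.
  move=> c0h; have := bg h; rewrite q8_mule c0h mulr0 addr0 => /eqP.
  rewrite !mulf_eq0 (negPf a0e) /= => /orP[/eqP //|/eqP c2h].
  by case: (@c_nz h).
have c0a h : c0 h = 0 -> a0 h = 0.
  move=> c0h; have := ag h; rewrite q8_emul c0h mulr0 addr0 => /eqP.
  rewrite !mulf_eq0 (negPf b1e) orbF => /orP[/eqP //|/eqP c2h].
  by case: (@c_nz h).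
have b1c h : b1 h = 0 -> c0 h = 0.
  move=> b1h; have := bg h; rewrite q8_mule b1h mulr0 mul0r add0r => /eqP.
  rewrite !mulf_eq0 (negPf a1e) /= => /orP[/eqP b2h|/eqP //].
  by case: (@b_nz h).
have a1c h : a1 h = 0 -> c2 h = 0.
  move=> a1h; have := ag h; rewrite q8_emul a1h !mul0r addr0 => /eqP.
  rewrite !mulf_eq0 (negPf b1e) orbF => /orP[/eqP a0h|/eqP //].
  by case: (@a_nz h).
have c2b h : c2 h = 0 -> b2 h = 0.
  move=> c2h; have := bg h; rewrite q8_mule c2h mulr0 add0r => /eqP.
  rewrite !mulf_eq0 (negPf a1e) /= => /orP[/eqP //|/eqP c0h].
  by case: (@c_nz h).
have c2a h : c2 h = 0 -> a1 h = 0.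
  move=> c2h; have := ag h; rewrite q8_emul c2h mulr0 add0r => /eqP.
  rewrite !mulf_eq0 (negPf b2e) orbF => /orP[/eqP //|/eqP c0h].
  by case: (@c_nz h).
have b2c h : b2 h = 0 -> c2 h = 0.
  move=> b2h; have := bg h; rewrite q8_mule b2h mulr0 mul0r addr0 => /eqP.
  rewrite !mulf_eq0 (negPf a0e) /= => /orP[/eqP b1h|/eqP //].
  by case: (@b_nz h).
have sq0 h : a0 h = 0 -> a0 (q8_mul h h) = 0.
  move=> a0h; apply: c0a; have := abc h h; rewrite a0h !mul0r add0r => /eqP.
  rewrite !mulf_eq0 => /orP[/orP[]|] /eqP // h0; first by case: (@a_nz h).
  by case: (@b_nz h); split=> //; apply/c0b/a0c.
have sq1 h : a1 h = 0 -> a1 (q8_mul h h) = 0.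
  move=> a1h; apply: c2a; have := abc h h; rewrite a1h !mul0r addr0 => /eqP.
  rewrite !mulf_eq0 => /orP[/orP[]|] /eqP // h0; first by case: (@a_nz h).
  by case: (@b_nz h); split=> //; apply/c2b/a1c.
have a0n h : a0 h != 0.
  apply/eqP => a0h; have := sq0 _ (sq0 _ a0h); rewrite q8_pow4.
  by apply/eqP.
have a1n h : a1 h != 0.
  apply/eqP => a1h; have := sq1 _ (sq1 _ a1h); rewrite q8_pow4.
  by apply/eqP.
split=> //; [move: (a0n g)|move: (a1n g)|move: (a0n g)]; apply: contraNneq => e0.
- by rewrite (c0a _ (b1c _ e0)).
- by rewrite (c2a _ (b2c _ e0)).
- by rewrite (c0a _ e0).
Qed.

Hypothesis O1 : a0 q8m * y = a1 q8m * x.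
Hypothesis O2 : b1 q8m * z = b2 q8m * y.
Hypothesis O3 : c0 q8m * z = c2 q8m * x.
Hypothesis O_nz : ~ [/\ x = 0, y = 0 & z = 0].

(* t1 g = a1 g / a0 g and t2 h = b2 h / b1 h satisfy t1 g t2 h = s (h g), so
   that s / s(e) is a homomorphism to F^*, hence trivial at -e = [i, j]. *)
Lemma qnf_field_char2 : 2%:R = 0 :> F.
Proof.
pose t1 g := a1 g / a0 g; pose t2 g := b2 g / b1 g; pose s g := - c2 g / c0 g.
have st g h : t1 g * t2 h = s (q8_mul h g).
  have [a0n a1n _ _ _] := qnf_field_nz g; have [_ _ b1n b2n _] := qnf_field_nz h.
  have [_ _ _ _ c0n] := qnf_field_nz (q8_mul h g).
  have e : a1 g * b2 h * c0 (q8_mul h g) = - (a0 g * b1 h * c2 (q8_mul h g)).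
    by apply/eqP; rewrite -addr_eq0 addrC abc.
  rewrite /t1 /t2 /s; apply: (mulIf c0n); rewrite divfK //.
  apply: (mulfI (mulf_neq0 a0n b1n)); rewrite mulrN -e; field.
  by rewrite a0n b1n.
have t1n g : t1 g != 0.
  by have [? ? _ _ _] := qnf_field_nz g; rewrite mulf_neq0 ?invr_eq0.
have t2n g : t2 g != 0.
  by have [_ _ ? ? _] := qnf_field_nz g; rewrite mulf_neq0 ?invr_eq0.
have sg g : s g = t1 g * t2 q8e by rewrite st q8_emul.
have sh h : s h = t1 q8e * t2 h by rewrite st q8_mule.
have hom g h : s (q8_mul h g) * s q8e = s g * s h.
  by rewrite -st (sg q8e) (sg g) (sh h); ring.
pose qi : q8 := (false, Qi); pose qj : q8 := (false, Qj); pose qk : q8 := (false, Qk).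
have sn g : s g != 0 by rewrite sg mulf_neq0.
(* -k = ji and k = ij, while the values of [s] commute. *)
have smk : s (q8_mul q8m qk) = s qk.
  apply: (mulIf (sn q8e)); rewrite -[q8_mul q8m qk]/(q8_mul qj qi) hom.
  by rewrite -[qk in RHS]/(q8_mul qi qj) hom mulrC.
have sm : s q8m = s q8e.
  by apply: (mulfI (sn qk)); rewrite -hom smk.
have t1m : t1 q8m = t1 q8e by apply: (mulIf (t2n q8e)); rewrite -!sg.
have t2m : t2 q8m = t2 q8e by apply: (mulfI (t1n q8e)); rewrite -!sh.
have [a0n _ b1n _ c0n] := qnf_field_nz q8m.
(* The first two lines through O give z = t1(-e) t2(-e) x = s(e) x, and the third gives z = -s(-e)
   x. The sign is the one in the definition of [s], which stems from the determinant. *)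
have yE : y = t1 q8m * x by rewrite /t1 mulrAC -O1 mulrAC divff // mul1r.
have zE : z = t2 q8m * y by rewrite /t2 mulrAC -O2 mulrAC divff // mul1r.
have zE' : z = - s q8m * x by rewrite /s !mulNr opprK mulrAC -O3 mulrAC divff // mul1r.
have x0 : x != 0.
  by apply/eqP => x0; apply: O_nz; rewrite zE' yE x0 !mulr0.
apply: (mulfI (mulf_neq0 (sn q8e) x0)); rewrite mulr0 mulr_natr mulr2n.
have -> : s q8e * x = z by rewrite zE yE t1m t2m sg; ring.
by rewrite {1}zE' sm mulNr; rewrite zE yE t1m t2m sg; ring.
Qed.

End QnfField.

(** * The Reid geometry *)

Section ReidRank.
Local Notation M := (reid 7).
Local Notation A := (@reid_block 7 'F_7 1).
Local Notation r01 n := (R01 (p := 7) (inord n)).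
Local Notation r11 n := (R11 (p := 7) (inord n)).

Lemma reid_rkE X : rk M X = block_rank A X.
Proof. by rewrite -(block_matroid_rkK (@reid_dvd 7)) mul1n. Qed.

Lemma reid_rk_le3 X : (rk M X <= 3)%N.
Proof. by rewrite reid_rkE rank_leq_col. Qed.

Lemma reid_rk_gt0 e : (0 < rk M [set e])%N.
Proof.
rewrite reid_rkE block_rank1 lt0n mxrank_eq0; apply/eqP.
have nz : (1%:M : 'M['F_7]_1) <> 0 by move/matrixP/(_ 0 0)/eqP; rewrite !mxE oner_eq0.
by case: e => [|||||i|i] /stack3_eq0[].
Qed.

Lemma reid_low a b c (x y : 'F_7) : A c = A a *m x%:M + A b *m y%:M ->
  (rk M [set a; b; c] < 3)%N.
Proof. by move=> /block_rank3_low; rewrite -reid_rkE. Qed.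

Lemma reid_full a b c :
  (forall e, e \in [:: R100 7; R010 7; R001 7] -> exists x y z : 'F_7, A e =
    A a *m x%:M + A b *m y%:M + A c *m z%:M) -> rk M [set a; b; c] = 3.
Proof.
move=> h; rewrite reid_rkE block_rank3; apply: stack3_full.
- have [|P [N [Q e]]] := h (R100 7); [by rewrite !inE eqxx ?orbT | exact: comb_sub3 e].
- have [|P [N [Q e]]] := h (R010 7); [by rewrite !inE eqxx ?orbT | exact: comb_sub3 e].
- have [|P [N [Q e]]] := h (R001 7); [by rewrite !inE eqxx ?orbT | exact: comb_sub3 e].
Qed.

Lemma stack3_lin2 (F : fieldType) k (x y : F) (B C D B' C' D' X Y Z : 'M[F]_k) :
  X = x *: B + y *: B' -> Y = x *: C + y *: C' -> Z = x *: D + y *: D' ->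
  stack3 X Y Z = stack3 B C D *m x%:M + stack3 B' C' D' *m y%:M.
Proof. by move=> -> -> ->; rewrite !stack3M !stack3D !mul_mx_scalar. Qed.

(** The ranks required by [algebraic_shadow]. The second generic point is (0, 1, 6) = (0, 1, -1),
    the end of the progression, because closing it up needs both coordinates of this point to be
    nonzero. *)
Lemma reid_basis : [/\ rk M [set R100 7; R010 7; R001 7] = 3,
  rk M [set R100 7; R110 7; R001 7] = 3, rk M [set R010 7; R110 7; R001 7] = 3,
  rk M [set R010 7; r01 5; R100 7] = 3 & rk M [set R001 7; r01 5; R100 7] = 3].
Proof.
have six : 6%:R = -1 :> 'F_7 by apply/eqP.
have six' : (-1)%:M = - 1%:M :> 'M['F_7]_1 by rewrite raddfN.
split; apply: reid_full => e; rewrite !inE => /or3P[] /eqP ->;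
  rewrite /= ?inordK // ?six ?six'.
- exists 1, 0, 0; by apply: stack3_lin; rewrite ?(scaler0, scale1r, scale0r, addr0, add0r).
- exists 0, 1, 0; by apply: stack3_lin; rewrite ?(scaler0, scale1r, scale0r, addr0, add0r).
- exists 0, 0, 1; by apply: stack3_lin; rewrite ?(scaler0, scale1r, scale0r, addr0, add0r).
- exists 1, 0, 0; by apply: stack3_lin; rewrite ?(scaler0, scale1r, scale0r, addr0, add0r).
- exists (-1), 1, 0; by apply: stack3_lin; rewrite ?(scaler0, scale1r, scale0r, scaleN1r, addNr, oppr0, addr0, add0r).
- exists 0, 0, 1; by apply: stack3_lin; rewrite ?(scaler0, scale1r, scale0r, addr0, add0r).
- exists (-1), 1, 0; by apply: stack3_lin; rewrite ?(scaler0, scale1r, scale0r, scaleN1r, addNr, oppr0, addr0, add0r).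
- exists 1, 0, 0; by apply: stack3_lin; rewrite ?(scaler0, scale1r, scale0r, addr0, add0r).
- exists 0, 0, 1; by apply: stack3_lin; rewrite ?(scaler0, scale1r, scale0r, addr0, add0r).
- exists 0, 0, 1; by apply: stack3_lin; rewrite ?(scaler0, scale1r, scale0r, addr0, add0r).
- exists 1, 0, 0; by apply: stack3_lin; rewrite ?(scaler0, scale1r, scale0r, addr0, add0r).
- exists 1, (-1), 0; by apply: stack3_lin; rewrite ?(scaler0, scale1r, scale0r, scaleN1r, opprK, subrr, oppr0, addr0, add0r).
- exists 0, 0, 1; by apply: stack3_lin; rewrite ?(scaler0, scale1r, scale0r, addr0, add0r).
- exists 1, 1, 0; by apply: stack3_lin; rewrite ?(scaler0, scale1r, scale0r, subrr, addr0, add0r).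
- exists 1, 0, 0; by apply: stack3_lin; rewrite ?(scaler0, scale1r, scale0r, addr0, add0r).
Qed.

Lemma reid_lows : [/\ (rk M [set R100 7; R010 7; R110 7] < 3)%N,
  (rk M [set R100 7; R001 7; R101 7] < 3)%N,
  (rk M [set R110 7; r01 5; R101 7] < 3)%N &
  (rk M [set R101 7; R010 7; r11 0] < 3)%N].
Proof.
have six : 6%:R = -1 :> 'F_7 by apply/eqP.
have six' : (-1)%:M = - 1%:M :> 'M['F_7]_1 by rewrite raddfN.
split.
- by apply: (@reid_low _ _ _ 1 1); rewrite /=; apply: stack3_lin2; rewrite ?(scaler0, scale1r, addr0, add0r).
- by apply: (@reid_low _ _ _ 1 1); rewrite /=; apply: stack3_lin2; rewrite ?(scaler0, scale1r, addr0, add0r).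
(* The closing line: (1, 1, 0) - (0, 1, 6) = (1, 0, 1), since 6 = -1 in the field with 7
   elements. *)
- have v5 : A (r01 5) = stack3 0 1%:M (- 1%:M) by rewrite /= inordK // six six'.
  apply: (@reid_low _ _ _ 1 (-1)); rewrite v5 /=; apply: stack3_lin2;
  by rewrite ?(scaler0, scale1r, scaleN1r, opprK, oppr0, subrr, addr0, add0r).
- apply: (@reid_low _ _ _ 1 1); rewrite /= inordK //; apply: stack3_lin2;
  by rewrite ?(scaler0, scale1r, addr0, add0r).
Qed.

Lemma reid_low01 i : (rk M [set R010 7; R001 7; R01 i] < 3)%N.
Proof.
apply: (@reid_low _ _ _ 1 i.+1%:R); rewrite /=; apply: stack3_lin2;
by rewrite ?(scale_scalar_mx, scaler0, scale1r, mulr1, addr0, add0r).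
Qed.

Lemma reid_low11 i : (rk M [set R001 7; R110 7; R11 i] < 3)%N.
Proof.
apply: (@reid_low _ _ _ i.+1%:R 1); rewrite /=; apply: stack3_lin2;
by rewrite ?(scale_scalar_mx, scaler0, scale1r, mulr1, addr0, add0r).
Qed.

Lemma reid_low0111 i : (rk M [set R100 7; R01 i; R11 i] < 3)%N.
Proof.
apply: (@reid_low _ _ _ 1 1); rewrite /=; apply: stack3_lin2;
by rewrite ?(scaler0, scale1r, addr0, add0r).
Qed.

Lemma reid_low_step n : (n.+1 < 6)%N ->
  (rk M [set R101 7; r01 n; r11 n.+1] < 3)%N.
Proof.
move=> ltn; apply: (@reid_low _ _ _ 1 1); rewrite /= !inordK //; last exact: ltnW.
apply: stack3_lin2; rewrite ?(scaler0, scale1r, addr0, add0r) //.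
by rewrite -raddfD /= -mulrS.
Qed.

End ReidRank.

(** * Slopes in a weak image of the Reid geometry *)

Section ReidField.
Variable F : fieldType.
(* The rows (u1, u2, 0), (w1, 0, w3), (0, a n, b n), (c n, f n, e n) stand for
   110, 101, 01(n+1), 11(n+1). *)
Variables (u1 u2 w1 w3 : F) (a b c f e : nat -> F).
Hypotheses (u1_nz : u1 != 0) (u2_nz : u2 != 0).
Hypothesis w_nz : ~ (w1 = 0 /\ w3 = 0).
Hypothesis ab_nz : forall n, ~ (a n = 0 /\ b n = 0).
Hypothesis cfe_nz : forall n, ~ [/\ c n = 0, f n = 0 & e n = 0].
Hypothesis r110 : forall n, u1 * f n = u2 * c n.
Hypothesis r100 : forall n, a n * e n = b n * f n.
Hypothesis r101_0 : w1 * e 0%N = w3 * c 0%N.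
Hypothesis r101 : forall n, (n.+1 < 6)%N ->
  w1 * (a n * e n.+1 - b n * f n.+1) = w3 * (a n * c n.+1).
Hypothesis r_w : u1 * (a 5 * w3) + u2 * (b 5 * w1) = 0.
Hypotheses (a5_nz : a 5 != 0) (b5_nz : b 5 != 0).

(** In slopes: e/f = b/a and c/f = u1/u2 at n, so the line through 101 reads b/a = b'/a' + (w3
    u1)/(w1 u2). The form without denominators also yields that a is nonzero at n, which allows
    iteration. *)
Lemma reid_step n a' b' : a' != 0 -> w1 != 0 ->
  w1 * (a' * e n - b' * f n) = w3 * (a' * c n) ->
  a n != 0 /\ a' * (b n * (w1 * u2)) = a n * (u2 * w1 * b' + w3 * u1 * a').
Proof.
move=> a'0 w10 r; have f0 : f n != 0.
  apply/eqP => f0; have c0 : c n = 0.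
    by have /esym/eqP := r110 n; rewrite f0 mulr0 mulf_eq0 (negPf u2_nz) => /eqP.
  apply: (@cfe_nz n); split=> //; move/eqP: r.
  by rewrite f0 c0 !mulr0 subr0 !mulf_eq0 (negPf w10) (negPf a'0) => /eqP.
have an0 : a n != 0.
  apply/eqP => an; apply: (@ab_nz n); split=> //.
  by have /esym/eqP := r100 n; rewrite an mul0r mulf_eq0 (negPf f0) orbF => /eqP.
split=> //; apply: (mulfI f0).
transitivity (u2 * w1 * a' * (b n * f n)); first by ring.
rewrite -r100; transitivity (u2 * a n * (w1 * (a' * e n - b' * f n))
  + a n * u2 * w1 * b' * f n); first by ring.
rewrite r; transitivity (a n * w3 * a' * (u2 * c n) + a n * u2 * w1 * b' * f n).
  by ring.
by rewrite -r110; ring.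
Qed.

Lemma reid_field_char7 : 7%:R = 0 :> F.
Proof.
have w30 : w3 != 0.
  apply/eqP => w30; apply: w_nz; split=> //; move/eqP: r_w.
  by rewrite w30 !mulr0 add0r !mulf_eq0 (negPf u2_nz) (negPf b5_nz) => /eqP.
have w10 : w1 != 0.
  apply/eqP => w10; move/eqP: r_w.
  by rewrite w10 !mulr0 addr0 !mulf_eq0 (negPf u1_nz) (negPf a5_nz) (negPf w30).
have slope n : (n < 6)%N ->
    a n != 0 /\ b n * (w1 * u2) = n.+1%:R * (w3 * u1) * a n.
  elim: n => [_|n IH ltn].
    (* The progression starts with slope 0, at the point 010. *)
    have [|a0 h] := @reid_step 0 1 0 (oner_neq0 _) w10.
      by rewrite mul0r !mul1r subr0.
    by split=> //; rewrite -[LHS]mul1r h; ring.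
  have [a0 h] := IH (ltnW ltn).
  have [a1 h1] := reid_step a0 w10 (r101 ltn).
  split=> //; apply: (mulfI a0); rewrite h1 -[n.+2]addn1 natrD.
  transitivity (a n.+1 * (b n * (w1 * u2) + w3 * u1 * a n)); first by ring.
  by rewrite h; ring.
(* With t = (w3 u1)/(w1 u2), the sixth slope is 6t by the progression and -t by [r_w]; so 7t = 0. *)
have [_ h] := slope 5 isT.
apply: (mulfI (mulf_neq0 (mulf_neq0 w30 u1_nz) a5_nz)); rewrite mulr0 -[RHS]r_w.
transitivity (u1 * (a 5 * w3) + 6%:R * (w3 * u1) * a 5); first by ring.
by rewrite -h; ring.
Qed.

End ReidField.

(** * The 2-linear representation *)

Section PrimeFieldMorphism.
Variables (F : fieldType) (p : nat).

Definition of_Fp of p \in [pchar F] := fun x : 'F_p => (x : nat)%:R : F.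

Hypothesis Fp : p \in [pchar F].

Lemma of_Fp_mod n : (n %% (Zp_trunc (pdiv p)).+2)%:R = n%:R :> F.
Proof.
by rewrite (Fp_cast (pcharf_prime Fp)) GRing.natr_mod_pchar.
Qed.

Lemma of_Fp_is_zmod_morphism : zmod_morphism (of_Fp Fp).
Proof.
move=> x y; apply/eqP; rewrite eq_sym subr_eq /of_Fp -natrD -[eqbRHS]of_Fp_mod.
by rewrite -{1}[x](subrK y).
Qed.

Lemma of_Fp_is_monoid_morphism : monoid_morphism (of_Fp Fp).
Proof.
split=> [|x y]; first by [].
by rewrite /of_Fp -natrM -[RHS]of_Fp_mod.
Qed.

HB.instance Definition _ :=
  GRing.isZmodMorphism.Build 'F_p F (of_Fp Fp) of_Fp_is_zmod_morphism.
HB.instance Definition _ :=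
  GRing.isMonoidMorphism.Build 'F_p F (of_Fp Fp) of_Fp_is_monoid_morphism.
End PrimeFieldMorphism.

Section BlockSums.
Variables (F : fieldType).

(** The sum is the image of a block diagonal matrix under an injective map. *)
Lemma rank_sum_free n1 n2 n m1 m2 (W1 : 'M[F]_(m1, n1)) (W2 : 'M[F]_(m2, n2))
    (L1 : 'M_(n1, n)) (L2 : 'M_(n2, n)) :
  row_free (col_mx L1 L2) ->
  \rank (W1 *m L1 + W2 *m L2)%MS = (\rank W1 + \rank W2)%N.
Proof.
move=> free; rewrite addsmxE -[W1 *m L1]addr0 -[W2 *m L2]add0r.
rewrite -[X in _ + X](mul0mx _ L2) -[X in X + W2 *m _](mul0mx _ L1).
rewrite -!mul_row_col -mul_col_mx mxrankMfree //.
exact: rank_diag_block_mx.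
Qed.

Lemma block_rank_mulr (E : finType) n n' k (A : E -> 'M[F]_(n, k)) (X : {set E})
    (L : 'M_(n, n')) :
  ((\sum_(e in X) <<(A e)^T>>)%MS *m L :=: \sum_(e in X) <<(A e)^T *m L>>)%MS.
Proof.
apply: (eqmx_trans (sumsmxMr_gen _ (fun e => <<(A e)^T>>%MS) L)); apply: eqmx_sums => e _.
apply: eqmx_trans (genmxE _) (eqmx_sym _).
exact: eqmx_trans (genmxE _) (eqmx_sym (eqmxMr _ (genmxE _))).
Qed.

Lemma block_rank_dsum (E1 E2 : finType) n1 n2 k (A1 : E1 -> 'M[F]_(n1, k))
    (A2 : E2 -> 'M[F]_(n2, k)) (X : {set E1 + E2}) :
  block_rank (fun e => match e with inl e1 => col_mx (A1 e1) 0
                                  | inr e2 => col_mx 0 (A2 e2) end) X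
  = (block_rank A1 (inl @^-1: X) + block_rank A2 (inr @^-1: X))%N.
Proof.
pose L1 : 'M[F]_(n1, n1 + n2) := row_mx 1%:M 0.
pose L2 : 'M[F]_(n2, n1 + n2) := row_mx 0 1%:M.
have free : row_free (col_mx L1 L2).
  apply/row_freeP; exists 1%:M; rewrite mulmx1 /L1 /L2.
  by rewrite -/(block_mx 1%:M 0 0 1%:M) -scalar_mx_block.
rewrite -(rank_sum_free _ _ free); apply: eqmx_rank.
have lt e1 : (col_mx (A1 e1) 0 : 'M_(n1 + n2, k))^T = (A1 e1)^T *m L1.
  by rewrite tr_col_mx trmx0 /L1 mul_mx_row mulmx1 mulmx0.
have rt e2 : (col_mx 0 (A2 e2) : 'M_(n1 + n2, k))^T = (A2 e2)^T *m L2.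
  by rewrite tr_col_mx trmx0 /L2 mul_mx_row mulmx1 mulmx0.
apply/eqmxP; apply: eqmx_trans; last first.
  apply: eqmx_sym; apply: adds_eqmx; apply: block_rank_mulr.
rewrite big_sumType /=; apply: adds_eqmx.
  rewrite (eq_bigr (fun e => <<(A1 e)^T *m L1>>%MS)) => [|e _]; last by rewrite lt.
  rewrite (eq_bigl (fun e => e \in inl @^-1: X)) // => e; by rewrite inE.
rewrite (eq_bigr (fun e => <<(A2 e)^T *m L2>>%MS)) => [|e _]; last by rewrite rt.
rewrite (eq_bigl (fun e => e \in inr @^-1: X)) // => e; by rewrite inE.
Qed.

Lemma block_rank_map (F' : fieldType) (f : {rmorphism F' -> F}) (E : finType) n k
    (A : E -> 'M[F']_(n, k)) X :
  block_rank (fun e => map_mx f (A e)) X = block_rank A X.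
Proof.
rewrite /block_rank -(mxrank_map f); apply: eqmx_rank.
apply/eqmxP/eqmx_sym.
apply: (big_ind2 (fun W W' => (map_mx f W :=: W')%MS)) => [|W1 W1' W2 W2' h1 h2|e _].
- by rewrite map_mx0.
- exact: eqmx_trans (map_addsmx _ _ _) (adds_eqmx h1 h2).
- apply: eqmx_trans (map_genmx _ _) _; rewrite map_trmx; exact: eqmx_refl.
Qed.

End BlockSums.
Section ReidDouble.
Variables (F : fieldType) (p : nat).

Lemma reid_block_scalar (e : reid_elt p) : exists a b c : F,
  forall k, reid_block F k e = stack3 a%:M b%:M c%:M.
Proof.
have z k : 0 = 0%:M :> 'M[F]_k by rewrite raddf0.
by case: e => [|||||i|i]; [exists 1, 0, 0|exists 0, 1, 0|exists 0, 0, 1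
  |exists 1, 1, 0|exists 1, 0, 1|exists 0, 1, i.+1%:R|exists 1, 1, i.+1%:R] => k;
  rewrite /= -?z.
Qed.

Let delta (r : 'I_2) : 'M[F]_(1, 2) := delta_mx 0 r.
(** [J r] places a row (x, y, z) in the r-th column of each block of width 2. The Reid blocks are
    scalar matrices, so the span for k = 2 is the direct sum of the images under [J 0] and [J 1] of
    the span for k = 1. *)
Let J (r : 'I_2) : 'M[F]_(1 + (1 + 1), 2 + (2 + 2)) :=
  block_mx (delta r) 0 0 (block_mx (delta r) 0 0 (delta r)).

Lemma reid_double_mul r s : J r *m (J s)^T = (r == s)%:R%:M.
Proof.
have dd : delta r *m (delta s)^T = (r == s)%:R%:M.
  rewrite trmx_delta mul_delta_mx_cond; apply/matrixP => i j.
  by rewrite !ord1 mulmxnE !mxE !eqxx.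
rewrite !tr_block_mx !trmx0 !mulmx_block !mulmx0 !mul0mx !(addr0, add0r) dd.
by rewrite -!scalar_mx_block.
Qed.

Lemma reid_double_row (e : reid_elt p) r :
  delta r *m (reid_block F 2 e)^T = (reid_block F 1 e)^T *m J r.
Proof.
have [a [b [c eE]]] := reid_block_scalar e; rewrite !eE /stack3.
rewrite !tr_col_mx !tr_scalar_mx !mul_mx_row /J !mul_row_block.
by rewrite !mulmx0 !(addr0, add0r) !mul_mx_scalar !mul_scalar_mx.
Qed.

Lemma reid_block_rank2 (X : {set reid_elt p}) :
  block_rank (@reid_block p F 2) X = (2 * block_rank (@reid_block p F 1) X)%N.
Proof.
have free : row_free (col_mx (J 0) (J 1)).
  apply/row_freeP; exists (row_mx (J 0)^T (J 1)^T).
  by rewrite mul_col_row !reid_double_mul /= raddf0 -scalar_mx_block.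
rewrite mul2n -addnn -(rank_sum_free _ _ free); apply: eqmx_rank.
apply/eqmxP; apply: eqmx_trans; last first.
  by apply: eqmx_sym; apply: adds_eqmx; apply: block_rank_mulr.
apply/eqmxP/andP; split.
  apply/sumsmx_subP => e eX; rewrite genmxE; apply/row_subP => i.
  rewrite rowE -/(delta i) reid_double_row.
  have [->|->] : i = 0 \/ i = 1.
    by case: i => [[|[|i]] lti] //; [left | right]; apply: val_inj.
  - apply: submx_trans (addsmxSl _ _).
    by apply: (sumsmx_sup e) => //; rewrite genmxE.
  - apply: submx_trans (addsmxSr _ _).
    by apply: (sumsmx_sup e) => //; rewrite genmxE.
rewrite addsmx_sub; apply/andP; split; apply/sumsmx_subP => e eX;
  rewrite genmxE -reid_double_row; apply: submx_trans (submxMl _ _) _;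
  by apply: (sumsmx_sup e) => //; rewrite genmxE.
Qed.

End ReidDouble.

Lemma reid_block_map (F : fieldType) p k (f : {rmorphism 'F_p -> F}) (e : reid_elt p) :
  reid_block F k e = map_mx f (reid_block 'F_p k e).
Proof.
have m0 : map_mx f (0 : 'M_k) = 0 by rewrite map_mx0.
have ms (n : nat) : map_mx f (n%:R%:M : 'M_k) = n%:R%:M.
  by rewrite map_scalar_mx rmorph_nat.
have m1 := ms 1.
by case: e => [|||||i|i]; rewrite /= /stack3 !map_col_mx ?m0 ?m1 ?ms.
Qed.

Lemma reid_rank2 (F : fieldType) p (X : {set reid_elt p}) : p \in [pchar F] ->
  block_rank (@reid_block p F 2) X = (2 * rk (reid p) X)%N.
Proof.
move=> Fp; rewrite reid_block_rank2 -[rk _ _]mul1n; congr (_ * _)%N.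
rewrite (block_matroid_rkK (@reid_dvd p)).
have [f _] : exists f : {rmorphism 'F_p -> F}, True.
  by exists (of_Fp Fp).
rewrite -(block_rank_map f); congr (block_rank _ X).
by apply/funext => e; apply: reid_block_map.
Qed.

Lemma qnf_reid_klinear (F49 : finFieldType) (card49 : #|F49| = 49%N)
    (zeta : F49) (zeta_prim : 4.-primitive_root zeta) :
  klinear 2 (dsum (qnf card49 zeta_prim) (reid 7)).
Proof.
split=> //; exists F49, _, (fun e => match e with
  | inl e1 => col_mx (qnf_block zeta e1) 0
  | inr e2 => col_mx 0 (reid_block F49 2 e2) end) => X.
rewrite block_rank_dsum mulnDr; congr (_ + _)%N; first exact: qnf_rkE.
by rewrite (reid_rank2 _ (pchar_card49 card49)).
Qed.

(** * The direct sum *)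

Section DirectSumRep.
Variables (K F : fieldType) (iota : {rmorphism K -> F}).
Variables (E1 E2 : finType) (M1 : matroid E1) (M2 : matroid E2).
Variable pi : E1 + E2 -> F.
Hypothesis rep : algebraic_rep iota (dsum M1 M2) pi.

Lemma rk_set0 (E : finType) (M : matroid E) : rk M set0 = 0%N.
Proof. by apply/eqP; have := rk_le_card M set0; rewrite cards0 leqn0. Qed.

Lemma dsum_rep_l (X : {set E1}) : trdeg_is iota
  (adjoin iota (fun x => exists2 e, e \in X & x = pi (inl e))) (rk M1 X).
Proof.
have := rep (inl @: X); rewrite /= /dsum_rk.
have -> : @inl E1 E2 @^-1: (inl @: X) = X.
  by apply/setP => e; rewrite inE mem_imset // => ? ? [].
have -> : @inr E1 E2 @^-1: (inl @: X) = set0.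
  by apply/setP => e; rewrite !inE; apply/imsetP => -[].
rewrite rk_set0 addn0; congr (trdeg_is _ (adjoin _ _) _).
apply/funext => x; apply/propext; split=> [[_ /imsetP[e eX ->] ->]|[e eX ->]].
  by exists e.
by exists (inl e) => //; apply: imset_f.
Qed.

Lemma dsum_rep_r (X : {set E2}) : trdeg_is iota
  (adjoin iota (fun x => exists2 e, e \in X & x = pi (inr e))) (rk M2 X).
Proof.
have := rep (inr @: X); rewrite /= /dsum_rk.
have -> : @inr E1 E2 @^-1: (inr @: X) = X.
  by apply/setP => e; rewrite inE mem_imset // => ? ? [].
have -> : @inl E1 E2 @^-1: (inr @: X) = set0.
  by apply/setP => e; rewrite !inE; apply/imsetP => -[].
rewrite rk_set0 add0n; congr (trdeg_is _ (adjoin _ _) _).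
apply/funext => x; apply/propext; split=> [[_ /imsetP[e eX ->] ->]|[e eX ->]].
  by exists e.
by exists (inr e) => //; apply: imset_f.
Qed.

End DirectSumRep.

(** * Characteristics forced by algebraic representations *)

Section Characteristics.
Variables (K F : fieldType) (iota : {rmorphism K -> F}).

Lemma qnf_algebraic_char2 (F49 : finFieldType) (card49 : #|F49| = 49%N)
    (zeta : F49) (zeta_prim : 4.-primitive_root zeta) (pi : qnf_elt -> F) :
  algebraic_rep iota (qnf card49 zeta_prim) pi -> 2%:R = 0 :> F.
Proof.
move=> rep; have [f1 f2 f3 f4 f5] := qnf_basis card49 zeta_prim.
have [d [db dnz ddep [u0 u1 u2] [v0 v1 v2]]] := algebraic_shadow rep
  (qnf_rk_le3 card49 zeta_prim) (qnf_rk_gt0 card49 zeta_prim) f1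
  (qnf_lowG1 card49 zeta_prim q8e) (qnf_lowG2 card49 zeta_prim q8e) f2 f3 f4 f5.
have d1 k : d P1 k = (o0 == k)%:R by rewrite -db ffunE.
have d2 k : d P2 k = (o1 == k)%:R by rewrite -db ffunE.
have d3 k : d P3 k = (o2 == k)%:R by rewrite -db ffunE.
pose dd := (d1, d2, d3).
have g1 g : d (G1 g) o2 = 0.
  have := ddep _ _ _ (qnf_lowG1 card49 zeta_prim g); rewrite /det3 !dd /= => <-; ring.
have g2 g : d (G2 g) o0 = 0.
  have := ddep _ _ _ (qnf_lowG2 card49 zeta_prim g); rewrite /det3 !dd /= => <-; ring.
have g3 g : d (G3 g) o1 = 0.
  have := ddep _ _ _ (qnf_lowG3 card49 zeta_prim g); rewrite /det3 !dd /= => e.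
  by apply: oppr_inj; rewrite oppr0 -e; ring.
have nz q : ~ [/\ d q o0 = 0, d q o1 = 0 & d q o2 = 0].
  move=> [e0 e1 e2]; have [k /eqP] := dnz q; apply.
  by case: (ord3P k) => ->.
apply: (@qnf_field_char2 F (fun g => d (G1 g) o0) (fun g => d (G1 g) o1)
  (fun g => d (G2 g) o1) (fun g => d (G2 g) o2)
  (fun g => d (G3 (q8_inv g)) o0) (fun g => d (G3 (q8_inv g)) o2)
  (d PO o0) (d PO o1) (d PO o2)) => //.
- by move=> g [e0 e1]; apply: (nz (G1 g)).
- by move=> g [e0 e1]; apply: (nz (G2 g)).
- by move=> g [e0 e1]; apply: (nz (G3 (q8_inv g))).
- move=> g h; have r := rho_inv g h (sqr_primitive4 zeta_prim).
  have := ddep _ _ _ (qnf_lowG card49 zeta_prim r).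
  by rewrite /det3 g1 g2 g3 => <-; ring.
- have := ddep _ _ _ (qnf_lowO1 card49 zeta_prim); rewrite /det3 !dd g1 /= => e.
  by apply/subr0_eq; rewrite -e; ring.
- have := ddep _ _ _ (qnf_lowO2 card49 zeta_prim); rewrite /det3 !dd g2 /= => e.
  by apply/subr0_eq; rewrite -e; ring.
- have := ddep _ _ _ (qnf_lowO3 card49 zeta_prim); rewrite /det3 !dd g3 /= => e.
  by apply/esym/subr0_eq; rewrite -e; ring.
Qed.

Lemma reid7_algebraic_char7 (pi : reid_elt 7 -> F) :
  algebraic_rep iota (reid 7) pi -> 7%:R = 0 :> F.
Proof.
move=> rep; have [f1 f2 f3 f4 f5] := reid_basis.
have [l1 l2 l3 l4] := reid_lows.
have [d [db dnz ddep [u0 u1 u2] [v0 v1 v2]]] := algebraic_shadow rep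
  reid_rk_le3 reid_rk_gt0 f1 l1 (reid_low01 (inord 5)) f2 f3 f4 f5.
have d1 k : d (R100 7) k = (o0 == k)%:R by rewrite -db ffunE.
have d2 k : d (R010 7) k = (o1 == k)%:R by rewrite -db ffunE.
have d3 k : d (R001 7) k = (o2 == k)%:R by rewrite -db ffunE.
pose dd := (d1, d2, d3).
have w1 : d (R101 7) o1 = 0.
  have := ddep _ _ _ l2; rewrite /det3 !dd /= => e.
  by apply: oppr_inj; rewrite oppr0 -e; ring.
have a0 i : d (R01 i) o0 = 0.
  have := ddep _ _ _ (reid_low01 i); rewrite /det3 !dd /= => <-; ring.
have nz q : ~ [/\ d q o0 = 0, d q o1 = 0 & d q o2 = 0].
  move=> [e0 e1 e2]; have [k /eqP] := dnz q; apply.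
  by case: (ord3P k) => ->.
apply: (@reid_field_char7 F (d (R110 7) o0) (d (R110 7) o1) (d (R101 7) o0)
  (d (R101 7) o2) (fun n => d (R01 (p := 7) (inord n)) o1)
  (fun n => d (R01 (p := 7) (inord n)) o2) (fun n => d (R11 (p := 7) (inord n)) o0)
  (fun n => d (R11 (p := 7) (inord n)) o1) (fun n => d (R11 (p := 7) (inord n)) o2)) => //.
- by move=> [e0 e2]; apply: (nz (R101 7)).
- by move=> n [e1 e2]; apply: (nz (R01 (p := 7) (inord n))).
- move=> n; have := ddep _ _ _ (reid_low11 (inord n)); rewrite /det3 !dd u2 /= => e.
  by apply/subr0_eq; rewrite -e; ring.
- move=> n; have := ddep _ _ _ (reid_low0111 (inord n)); rewrite /det3 !dd a0 /= => e.
  by apply/subr0_eq; rewrite -e; ring.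
- have := ddep _ _ _ l4; rewrite /det3 !dd w1 /= => e.
  by apply/subr0_eq; rewrite -e; ring.
- move=> n ltn; have := ddep _ _ _ (reid_low_step ltn); rewrite /det3 w1 a0 => e.
  by apply/subr0_eq; rewrite -e; ring.
- by have := ddep _ _ _ l3; rewrite /det3 w1 a0 u2 => <-; ring.
Qed.

End Characteristics.

Local Close Scope ring_scope.

Theorem corollary4p15 (F49 : finFieldType) (cardF49 : #|F49| = 49)
    (zeta4 : F49) (zeta4_prim : 4.-primitive_root%R zeta4) :
  klinear 2 (dsum (qnf cardF49 zeta4_prim) (reid 7)) /\
  ~ algebraic_matroid (dsum (qnf cardF49 zeta4_prim) (reid 7)).
Proof.
split; first exact: qnf_reid_klinear.
move=> [K [F [iota [pi rep]]]].
have c2 := qnf_algebraic_char2 (dsum_rep_l rep).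
have c7 := reid7_algebraic_char7 (dsum_rep_r rep).
have /eqP : (1 = 7%:R - 3%:R * 2%:R :> F)%R by ring.
by rewrite c2 c7 mulr0 subrr oner_eq0.
Qed.
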